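(* Let $k\ge 3$. Every graph $G\in\mathcal{G}_k$ has a $k$-balanced decomposition $\mathcal{D}$ in which every cycle has length $2k$.
   Context: All graphs are finite and simple; length = number of edges; girth = length of a shortest cycle. For $k\ge3$, $\mathcal{G}_k$ is the class of all $2k$-regular graphs of girth at least $2k-2$ admitting a pair of disjoint perfect matchings. A decomposition of a graph is a set of subgraphs whose edge sets partition its edge set. For $N\subset\mathbb{N}$, an $N$-decomposition is a decomposition into paths and cycles all of whose lengths lie in $N$. Given a $\{2k-1,2k,2k+1\}$-decomposition $\mathcal{D}$ of a graph and a vertex $v$, $\mathcal{D}$ is $k$-balanced at $v$ if the number of paths of $\mathcal{D}$ of length at most $2k$ having $v$ as an end vertex is at least the number of paths of $\mathcal{D}$ of length at least $2k+1$ having $v$ as an end vertex. $\mathcal{D}$ is a $k$-balanced decomposition if it is $k$-balanced at every vertex and the number of paths of length $2k-1$ in $\mathcal{D}$ equals the number of paths of length $2k+1$ in $\mathcal{D}$. *)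

(* Defs.v *)
From mathcomp Require Import all_boot.
Set Implicit Arguments. Unset Strict Implicit. Unset Printing Implicit Defensive.

Section Graphs.
Variable T : finType.

Definition simple_graph (e : rel T) : Prop := symmetric e /\ irreflexive e.

Definition gedges (e : rel T) : {set {set T}} :=
  [set [set xy.1; xy.2] | xy in [set xy : T * T | e xy.1 xy.2]].

Definition degree (e : rel T) (x : T) : nat := #|[set y | e x y]|.

Definition regular (e : rel T) (d : nat) : Prop := forall x, degree e x = d.

Definition is_gpath (e : rel T) (p : seq T) : bool :=
  if p is x :: s then [&& path e x s, uniq p & 1 <= size s] else false.

Definition is_gcycle (e : rel T) (c : seq T) : bool :=
  [&& cycle e c, uniq c & 3 <= size c].

Definition girth_at_least (e : rel T) (g : nat) : Prop :=
  forall c : seq T, is_gcycle e c -> g <= size c.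

Definition perfect_matching (e : rel T) (M : {set {set T}}) : Prop :=
  M \subset gedges e /\ forall x : T, #|[set m in M | x \in m]| = 1.

Definition in_Gk (k : nat) (e : rel T) : Prop :=
  simple_graph e /\ regular e (2 * k) /\ girth_at_least e (2 * k - 2) /\
  exists M1 M2 : {set {set T}},
    [/\ perfect_matching e M1, perfect_matching e M2 & M1 :&: M2 = set0].

Inductive piece := PPath of seq T | PCycle of seq T.

Definition piece_valid (e : rel T) (d : piece) : bool :=
  match d with PPath p => is_gpath e p | PCycle c => is_gcycle e c end.

Definition piece_edges (d : piece) : {set {set T}} :=
  match d with
  | PPath p => [set [set xy.1; xy.2] | xy in zip p (behead p)]
  | PCycle c => [set [set xy.1; xy.2] | xy in zip c (rot 1 c)]
  end.

Definition piece_length (d : piece) : nat :=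
  match d with PPath p => (size p).-1 | PCycle c => size c end.

Definition is_path_piece (d : piece) : bool :=
  if d is PPath _ then true else false.

Definition path_end (v : T) (d : piece) : bool :=
  match d with
  | PPath (x :: s) => (v == x) || (v == last x s)
  | _ => false
  end.

Definition decomposition (e : rel T) (D : seq piece) : Prop :=
  all (piece_valid e) D /\
  forall E, E \in gedges e -> count (fun d => E \in piece_edges d) D = 1.

Definition N_decomposition (e : rel T) (N : pred nat) (D : seq piece) : Prop :=
  decomposition e D /\ all (fun d => N (piece_length d)) D.

Definition k_balanced_at (k : nat) (D : seq piece) (v : T) : Prop :=
  count (fun d => is_path_piece d && (piece_length d <= 2 * k) && path_end v d) D
  >= count (fun d => is_path_piece d && (2 * k + 1 <= piece_length d) && path_end v d) D.

Definition k_balanced_decomposition (k : nat) (e : rel T) (D : seq piece) : Prop :=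
  N_decomposition e (fun n => (n == 2 * k - 1) || (n == 2 * k) || (n == 2 * k + 1)) D /\
  (forall v, k_balanced_at k D v) /\
  count (fun d => is_path_piece d && (piece_length d == 2 * k - 1)) D =
  count (fun d => is_path_piece d && (piece_length d == 2 * k + 1)) D.

End Graphs.

(* Main.v *)
(* Remove the two matchings.  The remaining (2k-2)-regular graph is oriented and
   split into k-1 permutations.  Start with the edges of the first matching as
   paths and apply permutations at both ends of all paths, one permutation after
   the other.  By the girth condition the paths of length at most 2k-3 so obtained
   are paths automatically; for the last permutation s, applied after r, a path may
   close into a cycle.  A pair (r, s) with the fewest such failures allows one
   to exchange arcs of r and s locally so that the whole graph minus the second
   matching is decomposed into paths of length 2k-1, every vertex being the end
   of exactly one path.  The edges of the second matching are then distributed: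
   some of them serve to form cycles of length 2k, and the others are attached to
   path ends, each path end being extended at most once. *)
Require Import Defs.
From mathcomp Require Import all_boot all_fingroup zify.
Set Implicit Arguments. Unset Strict Implicit. Unset Printing Implicit Defensive.

(** * Edge multiplicities of walks *)

Section Trails.
Variable T : finType.
Implicit Types (x y z a b c : T) (p q s : seq T) (E : {set T}).

(** Every path is stored twice, once under each of its ends, so that edge-disjointness and covering
    become additive identities in [mult] with both sides doubled. The girth acts in two ways. A
    trail on at most 2k-2 vertices is a path, and one on 2k-1 vertices can only repeat its first
    vertex as its last, which is the single kind of failure at the last permutation. Later, two
    chords from the start of a path on 2k vertices to vertices other than its far end would give a
    triangle, so of two candidate edges at most one is blocked. Repairing a failure at a bad [v]
    also affects the end at [nu v], so the repaired vertices must alternate with the others along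
    the bad stretches of [nu]. This can fail only if a whole cycle of [nu] is bad and has more than
    two elements; the minimal pair serves to remove these rings. *)

Definition edge x y : {set T} := [set x; y].

Lemma edgeC x y : edge x y = edge y x.
Proof. exact: setUC. Qed.

Lemma edge_eq x y a b :
  (edge x y == edge a b) = (x == a) && (y == b) || (x == b) && (y == a).
Proof.
apply/eqP/idP => [H|/orP[]/andP[/eqP-> /eqP->] //]; last exact: edgeC.
have := set21 x y; have := set22 x y; have := set21 a b; have := set22 a b.
rewrite -/(edge x y) -/(edge a b) -{1 2}H {3 4}H !in_set2 ![a == _]eq_sym ![b == _]eq_sym.
by do 4![case: eqP => //= _].
Qed.

Fixpoint mult E s : nat :=
  if s is x :: s' then (if s' is y :: _ then (E == edge x y) : nat else 0) + mult E s'
  else 0.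

Lemma mult_cons2 E x y s : mult E [:: x, y & s] = (E == edge x y) + mult E (y :: s).
Proof. by []. Qed.

Lemma mult_cat E p x q : mult E (p ++ x :: q) = mult E (rcons p x) + mult E (x :: q).
Proof.
elim: p => [|a [|b p] IH]; first by [].
  by rewrite [[:: a] ++ _]/= [rcons _ _]/= !mult_cons2 /= !addn0.
by move: IH; rewrite !cat_cons !rcons_cons !mult_cons2 => ->; rewrite addnA.
Qed.

Lemma mult_rcons2 E p x y :
  mult E (rcons (rcons p x) y) = mult E (rcons p x) + (E == edge x y).
Proof. by rewrite -[rcons (rcons p x) y]cats1 cat_rcons mult_cat /= !addn0. Qed.

Lemma mult_rcons E x p y :
  mult E (rcons (x :: p) y) = mult E (x :: p) + (E == edge (last x p) y).
Proof. by rewrite {1}lastI mult_rcons2 -lastI. Qed.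

Lemma mult_rev E p : mult E (rev p) = mult E p.
Proof.
elim: p => [|a [|b p] IH] //.
by rewrite !rev_cons mult_rcons2 -rev_cons IH mult_cons2 edgeC addnC.
Qed.

Lemma mult_wrap E a p c x y : head x p = x -> last y p = y -> p != [::] ->
  mult E (a :: rcons p c) = (E == edge a x) + mult E p + (E == edge y c).
Proof.
case/lastP: p => // p y'; rewrite last_rcons => + <- _.
case: p => [<-|x' p <-]; first by rewrite /= !addn0.
by rewrite mult_cons2 -!rcons_cons mult_rcons2 addnA.
Qed.

(* If [p] starts at [y], adding the edge [yz] to [p] and deleting the edge from
   the predecessor of [z] to [z] turns [p] into the path [rotate z p]. *)
Definition rotate z p := rev (take (index z p) p) ++ drop (index z p) p.

Lemma rotateE z p q : z \notin p -> rotate z (p ++ z :: q) = rev p ++ z :: q.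
Proof.
move=> zp; rewrite /rotate index_cat (negPf zp) /= eqxx addn0.
by rewrite take_size_cat // drop_size_cat.
Qed.

Lemma splitat z p : z \in p -> exists p1 p2, p = p1 ++ z :: p2 /\ z \notin p1.
Proof.
move=> zp; exists (take (index z p) p), (drop (index z p).+1 p); split.
  by rewrite -{2}(nth_index z zp) -drop_nth ?index_mem // cat_take_drop.
by rewrite in_take // ltnn.
Qed.

Definition pred_on z p := last z (take (index z p) p).

Lemma pred_onE z p q : z \notin p -> pred_on z (p ++ z :: q) = last z p.
Proof.
by move=> zp; rewrite /pred_on index_cat (negPf zp) /= eqxx addn0 take_size_cat.
Qed.

Lemma perm_rotate z p : perm_eq (rotate z p) p.
Proof. by rewrite -{2}(cat_take_drop (index z p) p) perm_cat2r perm_rev. Qed.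

Lemma size_rotate z p : size (rotate z p) = size p.
Proof. exact: perm_size (perm_rotate z p). Qed.

Lemma mem_rotate z p : rotate z p =i p.
Proof. exact: perm_mem (perm_rotate z p). Qed.

Lemma uniq_rotate z p : uniq (rotate z p) = uniq p.
Proof. exact: perm_uniq (perm_rotate z p). Qed.

Lemma last_rotate x z p : z \in p -> last x (rotate z p) = last x p.
Proof. by case/splitat=> p1 [p2 [-> H]]; rewrite rotateE // !last_cat. Qed.

Lemma head_rotate x y z s : z \in s -> z != y -> head x (rotate z (y :: s)) = pred_on z (y :: s).
Proof.
move=> /splitat [p1 [p2 [-> H]]] zy; rewrite -cat_cons.
have H' : z \notin y :: p1 by rewrite inE negb_or zy.
by rewrite rotateE // pred_onE // lastI rev_rcons /= last_rcons.
Qed.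

Lemma mult_rotate E y z s : z \in s -> z != y ->
  mult E (rotate z (y :: s)) + (E == edge (pred_on z (y :: s)) z)
  = mult E (y :: s) + (E == edge y z).
Proof.
move=> /splitat [p1 [p2 [-> H]]] zy; rewrite -cat_cons.
have H' : z \notin y :: p1 by rewrite inE negb_or zy.
rewrite rotateE // pred_onE // !mult_cat -rev_cons mult_rev mult_cons2.
rewrite [X in rcons X]lastI mult_rcons2 -lastI (edgeC z) [last z _]/=; lia.
Qed.

Lemma pred_on_edge E z y s : z \in s -> z != y ->
  (E == edge (pred_on z (y :: s)) z) <= mult E (y :: s).
Proof.
move=> /splitat [p1 [p2 [-> H]]] zy; rewrite -cat_cons.
have H' : z \notin y :: p1 by rewrite inE negb_or zy.
rewrite pred_onE // mult_cat mult_rcons [last z _]/=; lia.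
Qed.

End Trails.

Section Pieces.
Variable T : finType.
Implicit Types (x y z a b c : T) (p q s : seq T) (E : {set T}).

Lemma path_edgesE E p :
  (E \in [set [set xy.1; xy.2] | xy in zip p (behead p)]) = (0 < mult E p).
Proof.
elim: p => [|x [|y p] IH].
- by apply/imsetP => -[[]].
- by apply/imsetP => -[[]].
rewrite mult_cons2 addn_gt0 -IH /=; apply/imsetP/orP.
  case=> [[a b]]; rewrite inE => /orP[/eqP[-> ->] ->|H ->]; first by rewrite eqxx; left.
  by right; apply/imsetP; exists (a, b).
case=> [|/imsetP[[a b] H ->]]; last by exists (a, b); rewrite // inE H orbT.
by rewrite lt0b => /eqP ->; exists (x, y); rewrite ?inE ?eqxx.
Qed.

Definition closed_walk p := if p is x :: _ then rcons p x else [::].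

Lemma cycle_edgesE E p :
  (E \in [set [set xy.1; xy.2] | xy in zip p (rot 1 p)]) = (0 < mult E (closed_walk p)).
Proof.
rewrite -path_edgesE; case: p => [|x s] //=; rewrite rot1_cons.
suff -> : zip (x :: rcons s x) (rcons s x) = zip (x :: s) (rcons s x) by [].
by elim: s {1 4}x => [|y s IH] u //=; rewrite IH.
Qed.

Definition piece_mult E (d : piece T) : nat :=
  match d with PPath p => mult E p | PCycle c => mult E (closed_walk c) end.

Lemma piece_edgesE E d : (E \in piece_edges d) = (0 < piece_mult E d).
Proof. by case: d => p; [exact: path_edgesE | exact: cycle_edgesE]. Qed.

(** The bridge from additive counting to [decomposition]: total multiplicity 1 leaves room for
    exactly one piece through [E]. *)
Lemma count_piece_edges E (D : seq (piece T)) :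
  \sum_(d <- D) piece_mult E d = 1 -> count (fun d => E \in piece_edges d) D = 1.
Proof.
elim: D => [|d D IH]; first by rewrite big_nil.
rewrite big_cons /= piece_edgesE; case: (piece_mult E d) => [|[|//]] /=; first by move/IH->.
case; rewrite add0n => H; rewrite -[RHS]addn0; congr addn; apply/eqP.
rewrite eqn0Ngt -has_count -all_predC.
elim: D H {IH} => [|f D IH] //=; rewrite big_cons => /eqP; rewrite addn_eq0.
by case/andP=> /eqP H /eqP H'; rewrite IH // /= piece_edgesE H.
Qed.

End Pieces.

(** * Trails and girth *)

Section Girth.
Variables (T : finType) (e : rel T) (g : nat).
Hypotheses (esym : symmetric e) (eirr : irreflexive e) (eg : girth_at_least e g).
Implicit Types (x y z a b c : T) (p q s : seq T) (E : {set T}).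

Lemma mem_gedges x y : (edge x y \in gedges e) = e x y.
Proof.
apply/imsetP/idP => [[[a b]]|H]; last by exists (x, y); rewrite ?inE.
rewrite inE /= => eab /eqP; rewrite -/(edge x y) -/(edge a b) edge_eq.
by case/orP=> /andP[/eqP-> /eqP->] //; rewrite esym.
Qed.

Lemma gedgesP E : reflect (exists x y, e x y /\ E = edge x y) (E \in gedges e).
Proof.
apply: (iffP idP) => [/imsetP[[x y]]|[x [y [H ->]]]]; last by rewrite mem_gedges.
by rewrite inE /= => H ->; exists x, y.
Qed.

(** The boolean bound does double duty: it forbids steps outside the graph (bound 0) and repeated
    edges (bound 1). *)
Definition trail p := forall E, mult E p <= (E \in gedges e).

Lemma trail_cons a p : trail (a :: p) -> trail p.
Proof. by move=> H E; apply: leq_trans (H E); rewrite /= leq_addl. Qed.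

Lemma trail_edge a b p : trail [:: a, b & p] -> e a b.
Proof.
by move=> /(_ (edge a b)); rewrite mult_cons2 eqxx -mem_gedges; case: (_ \in _).
Qed.

Lemma trail_path a p : trail (a :: p) -> path e a p.
Proof.
elim: p a => [|b p IH] a //= H; rewrite (trail_edge H) /=.
exact: IH (trail_cons H).
Qed.

(** The first return to [a] closes a walk with [(index a p).+1] edges. Length 1 would be a loop and
    length 2 would repeat an edge, so it is a cycle and the girth applies. *)
Lemma back_edge a p : trail (a :: p) -> uniq p -> a \in p -> g <= (index a p).+1.
Proof.
move=> H up /splitat [p1 [p2 [pE ap1]]].
have -> : (index a p).+1 = size (a :: p1).
  by rewrite pE index_cat (negPf ap1) /= eqxx addn0.
apply: eg; rewrite /is_gcycle; move: H up; rewrite pE => H.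
rewrite cat_uniq /= => /and4P[up1 _ _ _]; rewrite ap1 up1 andbT.
have := trail_path H; rewrite -cat_rcons cat_path => /andP[-> _] /=.
case: p1 H {pE up1 ap1} => [|b [|b' p1]] //= H.
  by have := trail_edge H; rewrite eirr.
have := H (edge a b); rewrite !mult_cons2 (edgeC b) eqxx.
by case: (_ \in _).
Qed.

Lemma trail_uniq p : trail p -> size p <= g -> uniq p.
Proof.
elim: p => [|a p IH] //= H sp; have up := IH (trail_cons H) (ltnW sp).
rewrite up andbT; apply/negP => ap; have := back_edge H up ap.
by rewrite leqNgt (leq_ltn_trans _ sp) // index_mem.
Qed.

Lemma no_triangle x y z : 3 < g -> e x y -> e y z -> e z x -> False.
Proof.
move=> g3 exy eyz ezx.
suff /eg : is_gcycle e [:: x; y; z] by rewrite leqNgt g3.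
rewrite /is_gcycle /= exy eyz ezx !inE negb_or !andbT.
have ne u v : e u v -> u != v by move=> H; apply: contraTneq H => ->; rewrite eirr.
by rewrite (ne _ _ exy) (ne _ _ eyz) eq_sym (ne _ _ ezx).
Qed.

End Girth.

(** * Halving sums over the pairs of an involution *)

Section Pairing.
Variables (I : finType) (U : {set I}) (o : I -> I) (c : I -> bool).
Hypotheses (oU : {in U, forall v, o v \in U}) (oK : {in U, involutive o})
  (oc : {in U, forall v, c (o v) = ~~ c v}).

Lemma sum_half (F : I -> nat) :
  \sum_(v in U | ~~ c v) F v = \sum_(v in U | c v) F (o v).
Proof.
rewrite (reindex_onto o o) => [|v /andP[vU _]]; last exact: oK.
apply: eq_bigl => v; have [ovU|ovU] := boolP (o v \in U); last first.
  by apply/esym/negP => /andP[/oU]; rewrite (negPf ovU).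
have [E|E] := o (o v) =P v; last first.
  by rewrite andbF; apply/esym/negP => /andP[vU _]; apply: E; exact: oK.
have vU : v \in U by rewrite -E oU.
by rewrite vU oc // negbK andbT.
Qed.

Lemma sum_pair (F : I -> nat) :
  \sum_(v in U) F v = \sum_(v in U | c v) (F v + F (o v)).
Proof. by rewrite big_split /= -(sum_half F) [LHS](bigID c). Qed.

End Pairing.

Lemma count_sum (A : Type) (p : A -> bool) (D : seq A) :
  count p D = \sum_(d <- D) p d.
Proof. by elim: D => [|d D IH] /=; rewrite ?big_nil // big_cons IH. Qed.

(** * Attaching a matching to the ends of paths *)

(* Every path occurs twice, once for each of its two ends ("slots"): the path of
   the slot [v] is read from the end [en v], and [o v] is the slot of its other
   end.  The slots are matched by [sigma]; the slot [v] with [X v] is extended by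
   the edge joining its end to the end of [sigma v].  Hence at every vertex the
   extended ends are as many as the ends that were not extended, and a path of
   length [2k+1] has both ends extended. *)
Section Attach.
Variables (T : finType) (e : rel T) (k : nat) (I : finType) (U : {set I}).
Variables (P : I -> seq T) (en : I -> T) (o sigma : I -> I) (c X : I -> bool).
Hypotheses (esym : symmetric e) (k_gt0 : 0 < k).
Hypotheses (oU : {in U, forall v, o v \in U}) (oK : {in U, involutive o})
  (oc : {in U, forall v, c (o v) = ~~ c v}).
Hypotheses (sU : {in U, forall v, sigma v \in U}) (sK : {in U, involutive sigma})
  (sX : {in U, forall v, X (sigma v) = ~~ X v}).
Hypotheses (Prev : {in U, forall v, P (o v) = rev (P v)})
  (Psize : {in U, forall v, size (P v) = 2 * k})
  (Puniq : {in U, forall v, uniq (P v)})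
  (Pen : {in U, forall v, P v = en v :: behead (P v)}).
Hypotheses (Xnotin : {in U, forall v, X v -> en (sigma v) \notin P v})
  (Xneq : {in U, forall v, X v -> X (o v) -> en (sigma v) != en (sigma (o v))}).

Let W E := \sum_(v in U) (mult E (P v) + (E == edge (en v) (en (sigma v)))).
Hypothesis (Wle : forall E, W E <= 2 * (E \in gedges e)).

Let cap v := if X v then [:: en (sigma v)] else [::].
Let Q v := cap v ++ P v ++ cap (o v).
Let h v := if X v then en (sigma v) else en v.

Let lastP v x : v \in U -> last x (P v) = en (o v).
Proof. by move=> vU; rewrite -(revK (P v)) -Prev // Pen ?oU // rev_cons last_rcons. Qed.

Let multQ E v : v \in U -> mult E (Q v) = mult E (P v)
  + (X v && (E == edge (en v) (en (sigma v))))
  + (X (o v) && (E == edge (en (o v)) (en (sigma (o v))))).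
Proof.
move=> vU; rewrite /Q /cap; have L := lastP (en v) vU.
move: L; rewrite Pen //=; move: (behead _) => s <-.
have HX a : mult E (en v :: s ++ (if a then [:: en (sigma (o v))] else [::])) =
    mult E (en v :: s) + (a && (E == edge (last (en v) s) (en (sigma (o v))))).
  by case: a; rewrite ?cats0 ?addn0 // cats1 -rcons_cons mult_rcons.
have HY a x q : mult E ((if a then [:: x] else [::]) ++ en v :: q) =
    mult E (en v :: q) + (a && (E == edge (en v) x)).
  by case: a => //=; rewrite ?addn0 // addnC edgeC.
by rewrite HY HX addnAC.
Qed.

(** A matching edge is counted at both of its slots but attached at only one, while every path is
    read from both ends; so a common factor 2 comes out. *)
Let wtE E : W E = 2 * \sum_(v in U | c v) mult E (Q v).
Proof.
rewrite /W big_split /=.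
rewrite (sum_pair sU sK sX (fun v => (E == edge (en v) (en (sigma v))) : nat)).
rewrite (sum_pair oU oK oc) big_distrr /=.
have -> : \sum_(v in U | X v) ((E == edge (en v) (en (sigma v))) +
     (E == edge (en (sigma v)) (en (sigma (sigma v)))))
  = \sum_(v in U) 2 * (X v && (E == edge (en v) (en (sigma v)))).
  rewrite [RHS](bigID X) /= [X in _ = _ + X]big1 => [|v /andP[_ /negbTE-> //]].
  rewrite addn0; apply: eq_bigr => v /andP[vU ->].
  by rewrite sK // (edgeC (en (sigma v))) mul2n addnn.
rewrite (sum_pair oU oK oc) -big_split /=; apply: eq_bigr => v /andP[vU _].
rewrite multQ // Prev // mult_rev; lia.
Qed.

Let trailQ v : v \in U -> c v -> trail e (Q v).
Proof.
move=> vU cv E; have := Wle E; rewrite wtE (bigD1 v) ?vU //=; lia.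
Qed.

Let headQ v : v \in U -> exists s, Q v = h v :: s.
Proof.
move=> vU; rewrite /Q /cap /h Pen //; case: (X v) => /=; by eexists.
Qed.

Let revQ v : v \in U -> Q (o v) = rev (Q v).
Proof.
move=> vU; rewrite /Q oK // !rev_cat Prev // -catA.
by congr (_ ++ (_ ++ _)); rewrite /cap; case: (X _).
Qed.

Let uniqQ v : v \in U -> uniq (Q v).
Proof.
move=> vU; rewrite /Q; have Pu := Puniq vU.
have := Xnotin vU; have := Xnotin (oU vU); rewrite Prev // mem_rev.
have := Xneq vU; rewrite /cap.
case: (X v); case: (X (o v)) => N Ho Hv; rewrite ?cats0 ?cat0s // ?cats1 ?cat1s /=.
- by rewrite mem_rcons inE negb_or rcons_uniq N // Ho // Hv.
- by rewrite Hv.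
- by rewrite rcons_uniq Ho.
Qed.

Let sizeQ v : v \in U -> size (Q v) = 2 * k + X v + X (o v).
Proof.
move=> vU; rewrite /Q !size_cat Psize // /cap; case: (X v); case: (X (o v)) => /=; lia.
Qed.

(** The disjunction in [path_end] equals this sum only because the two ends of [Q v] differ. *)
Let endQ u v : v \in U -> path_end u (PPath (Q v)) = (u == h v) + (u == h (o v)) :> nat.
Proof.
move=> vU; have [s Es] := headQ vU; have [s' Es'] := headQ (oU vU).
have L : last (h v) s = h (o v).
  by rewrite -[LHS]/(last (h v) (h v :: s)) -Es -(revK (Q v)) -revQ // Es' rev_cons last_rcons.
have := uniqQ vU; have := sizeQ vU; rewrite Es /= L.
case: s L {Es} => [|a s] /= L; first lia.
move=> _ /andP[N _]; have : h v != h (o v) by rewrite -L; apply: contraNneq N => ->; rewrite mem_last.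
by move=> hne; case: (u =P h v) => [->|_] //=; rewrite (negPf hne).
Qed.

Lemma attach : exists D : seq (piece T),
  [/\ all (piece_valid e) D /\ all (@is_path_piece T) D,
      all (fun d => piece_length d \in [:: 2 * k - 1; 2 * k; 2 * k + 1]) D,
      forall v, k_balanced_at k D v,
      count (fun d => is_path_piece d && (piece_length d == 2 * k - 1)) D =
      count (fun d => is_path_piece d && (piece_length d == 2 * k + 1)) D &
      forall E, 2 * \sum_(d <- D) piece_mult E d = W E].
Proof.
pose D := [seq PPath (Q v) | v <- enum [pred v in U | c v]].
have allD (p : piece T -> bool) : (forall v, v \in U -> c v -> p (PPath (Q v))) -> all p D.
  by move=> H; rewrite all_map; apply/allP => v; rewrite mem_enum => /andP[vU cv]; exact: H.
have sumD (F : piece T -> nat) : \sum_(d <- D) F d = \sum_(v in U | c v) F (PPath (Q v)).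
  by rewrite big_map big_enum.
exists D; split.
- split; apply: allD => v vU cv //=.
  have := trailQ vU cv; have := uniqQ vU; have := sizeQ vU.
  case: (Q v) => [|a s] /=; first by move=> H; exfalso; move: H k_gt0; clear; lia.
  move=> H -> /(trail_path esym) -> /=; move: H k_gt0; clear; lia.
- apply: allD => v vU cv; rewrite /= sizeQ // !inE.
  move: k_gt0; clear; case: (X v); case: (X (o v)); lia.
- move=> u; rewrite /k_balanced_at !count_sum !sumD.
  (* If [X v] holds, the slots [v] and [sigma v] both end at [en (sigma v)], the first extended and
     the second not. *)
  have ends : \sum_(v in U | c v) (X v * (u == h v) + X (o v) * (u == h (o v)))
    = \sum_(v in U | c v) (~~ X v * (u == h v) + ~~ X (o v) * (u == h (o v))).
    rewrite -(sum_pair oU oK oc (fun v => X v * (u == h v))).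
    rewrite -(sum_pair oU oK oc (fun v => ~~ X v * (u == h v))).
    rewrite (bigID X) [RHS](bigID X) /=.
    rewrite [X in _ + X = _]big1 => [|v /andP[_ /negbTE->] //].
    rewrite [X in _ = X + _]big1 => [|v /andP[_ ->] //].
    rewrite (sum_half sU sK sX) addn0; apply: eq_bigr => v /andP[vU Xv].
    by rewrite /h sX // Xv /= .
  (* Ends of paths of length 2k+1 are extended ends, and unextended ends lie on paths of length at
     most 2k; [ends] links the two bounds. *)
  apply: (@leq_trans (\sum_(v in U | c v) (X v * (u == h v) + X (o v) * (u == h (o v))))).
    apply: leq_sum => v /andP[vU _]; rewrite -mulnb endQ //= sizeQ //.
    move: k_gt0; clear; case: (X v); case: (X (o v)); case: (u == _); case: (u == _) => /=; lia.
  rewrite ends; apply: leq_sum => v /andP[vU _]; rewrite -mulnb endQ //= sizeQ //.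
  move: k_gt0; clear; case: (X v); case: (X (o v)); case: (u == _); case: (u == _) => /=; lia.
(* Half of the slots are extended, one per path on average, so paths with no and with two extensions
   are equally many. Termwise, [length 2k-1] plus the number of extensions equals [length 2k+1] plus
   1. *)
- have H : \sum_(v in U | c v) (X v + X (o v)) = \sum_(v in U | c v) 1.
    rewrite -(sum_pair oU oK oc (fun v => X v : nat)).
    transitivity (\sum_(v in U | X v) 1).
      by rewrite (sum_pair sU sK sX); apply: eq_bigr => v /andP[vU Xv]; rewrite sX // Xv.
    have H1 := sum_pair sU sK sX (fun _ => 1); have H2 := sum_pair oU oK oc (fun _ => 1).
    move: H1 H2; rewrite !big_split /= => -> ; clear; lia.
  rewrite !count_sum !sumD; apply/eqP.
  rewrite -(eqn_add2r (\sum_(v in U | c v) (X v + X (o v)))) {2}H -!big_split /=.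
  apply/eqP/eq_bigr => v /andP[vU _]; rewrite sizeQ //.
  move: k_gt0; clear; case: (X v); case: (X (o v)) => /=; lia.
- by move=> E; rewrite wtE sumD.
Qed.

End Attach.

(** * Alternating cycles of two involutions *)

Section Colouring.
Variables (I : finType) (U : {set I}) (o m : I -> I).
Hypotheses (oU : {in U, forall v, o v \in U}) (oK : {in U, involutive o})
  (on : {in U, forall v, o v != v}).
Hypotheses (mU : {in U, forall v, m v \in U}) (mK : {in U, involutive m})
  (mn : {in U, forall v, m v != v}).

(** The pairs of [o] and of [m] are two perfect matchings of [U], and their union consists of even
    alternating cycles. [f] goes two steps along such a cycle, so its orbits are the colour
    classes. *)
Lemma bicolouring : exists c : I -> bool,
  {in U, forall v, c (o v) = ~~ c v} /\ {in U, forall v, c (m v) = ~~ c v}.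
Proof.
pose f v := if v \in U then m (o v) else v.
have fU v : (f v \in U) = (v \in U).
  by rewrite /f; case: ifP => // vU; rewrite mU // oU.
have finj : injective f.
  move=> u v E; have := fU u; rewrite E fU; move: E; rewrite /f.
  case: ifP => uU; case: ifP => vU // E _; have := congr1 m E.
  by rewrite !mK ?oU // => /(congr1 o); rewrite !oK.
(* [o] conjugates [f] to its inverse, so an orbit containing [v] and [o v]
   would contain a fixed point of [o] or of [m]. *)
have nconn n : forall v, v \in U -> iter n f v <> o v.
  elim/ltn_ind: n => -[|[|n]] IH v vU /=; first by apply/eqP; rewrite eq_sym on.
    by rewrite /f vU; apply/eqP/mn/oU.
  rewrite -iterS iterSr => E; have fvU : f v \in U by rewrite fU.
  apply: (IH n _ (f v)) => //; apply: finj; rewrite -iterS iterS E.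
  by rewrite [f v in RHS]/f vU /f oU ?mU ?oU // oK ?mU ?oU // mK ?oU.
have froot_neq v : v \in U -> froot f v != froot f (o v).
  move=> vU; rewrite (root_connect (fconnect_sym finj)).
  by apply/negP => /iter_findex; exact: nconn.
have froot_m v : v \in U -> froot f (m v) = froot f (o v).
  move=> vU; apply/eqP; rewrite eq_sym (root_connect (fconnect_sym finj)).
  by have := fconnect1 f (o v); rewrite {2}/f oU // oK.
have froot_om v : v \in U -> froot f (o (m v)) = froot f v.
  move=> vU; apply/eqP; rewrite (root_connect (fconnect_sym finj)).
  by have := fconnect1 f (o (m v)); rewrite {2}/f oU ?mU // oK ?mU // mK.
(* The ranks of the two roots merely decide which of the two orbits on an alternating cycle gets the
   colour. *)
pose c v := enum_rank (froot f v) < enum_rank (froot f (o v)).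
have co : {in U, forall v, c (o v) = ~~ c v}.
  move=> v vU; rewrite /c oK // -leqNgt [RHS]leq_eqVlt.
  by rewrite (inj_eq (@ord_inj _)) (inj_eq enum_rank_inj) eq_sym (negPf (froot_neq v vU)).
exists c; split=> // v vU.
by rewrite {1}/c froot_m // froot_om // -(co v vU) /c oK.
Qed.

End Colouring.

Lemma sum_ge2 (I : finType) (U : {set I}) (F : I -> nat) a b :
  a \in U -> b \in U -> a != b -> F a + F b <= \sum_(i in U) F i.
Proof.
move=> aU bU ab; rewrite (bigD1 a) //= (bigD1 b) ?bU 1?eq_sym //= addnA.
exact: leq_addr.
Qed.

(** * Reductions producing cycles of length 2k *)

Section Linked.
Variables (T : finType) (e : rel T) (k : nat).
Hypotheses (esym : symmetric e) (eirr : irreflexive e) (k3 : 3 <= k).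
Hypothesis eg : girth_at_least e (2 * k - 2).
Implicit Types (U : {set T}) (P : T -> seq T) (o m : T -> T) (E : {set T}).

(* Both every path and every matching edge are counted twice. *)
Definition wt U P m E := \sum_(v in U) (mult E (P v) + (E == edge v (m v))).

(** [wt_le] is an inequality because [U] shrinks as cycles are split off. It says at once that paths
    and matching edges lie in the graph and are edge-disjoint. *)
Record linked U P o m : Prop := Linked {
  o_in : {in U, forall v, o v \in U};
  oK : {in U, involutive o};
  o_neq : {in U, forall v, o v != v};
  m_in : {in U, forall v, m v \in U};
  mK : {in U, involutive m};
  P_rev : {in U, forall v, P (o v) = rev (P v)};
  P_size : {in U, forall v, size (P v) = 2 * k};
  P_uniq : {in U, forall v, uniq (P v)};
  P_head : {in U, forall v, P v = v :: behead (P v)};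
  wt_le : forall E, wt U P m E <= 2 * (E \in gedges e) }.

Record good (W : {set T} -> nat) (D : seq (piece T)) : Prop := Good {
  good_valid : all (piece_valid e) D;
  good_length : all (fun d => piece_length d \in [:: 2 * k - 1; 2 * k; 2 * k + 1]) D;
  good_balanced : forall v, k_balanced_at k D v;
  good_count : count (fun d => is_path_piece d && (piece_length d == 2 * k - 1)) D =
      count (fun d => is_path_piece d && (piece_length d == 2 * k + 1)) D;
  good_cycles : all (fun d => ~~ is_path_piece d ==> (piece_length d == 2 * k)) D;
  good_wt : forall E, 2 * \sum_(d <- D) piece_mult E d = W E }.

Lemma good_cycle W W' D p : is_gcycle e p -> size p = 2 * k ->
  (forall E, W' E = W E + 2 * mult E (closed_walk p)) -> good W D -> good W' (PCycle p :: D).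
Proof.
move=> cp sp WE [h1 h2 h3 h4 h5 h6]; split=> //=.
- by rewrite cp.
- by rewrite h2 sp !inE eqxx orbT.
- by rewrite sp eqxx.
- by move=> E; rewrite big_cons mulnDr h6 addnC WE.
Qed.

Section Facts.
Variables (U : {set T}) (P : T -> seq T) (o m : T -> T).
Hypothesis L : linked U P o m.
Implicit Types v w x y z : T.

Lemma P_last x v : v \in U -> last x (P v) = o v.
Proof.
move=> vU; rewrite -(revK (P v)) -(P_rev L) // (P_head L) ?(o_in L) //.
by rewrite rev_cons last_rcons.
Qed.

(** The path is counted under [v] and [o v], the matching edge under [w] and [m w], so the left side
    occurs twice in [wt]. The case [m w = w] would make a loop an edge. *)
Lemma mult_path_m E v w : v \in U -> w \in U ->
  mult E (P v) + (E == edge w (m w)) <= (E \in gedges e).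
Proof.
move=> vU wU; have := wt_le L E; rewrite /wt big_split /=.
have h1 := sum_ge2 (fun v => mult E (P v)) (o_in L vU) vU (o_neq L vU).
rewrite (P_rev L) // mult_rev in h1.
have [mw|mw] := eqVneq (m w) w.
  have : w \in U := wU; rewrite mw; have := wt_le L (edge w w).
  rewrite mem_gedges // eirr muln0 leqn0 sum_nat_eq0 => /forall_inP /(_ w wU).
  by rewrite mw eqxx addn1.
have h2 := sum_ge2 (fun v => (E == edge v (m v)) : nat) (m_in L wU) wU mw.
rewrite /= (mK L) // (edgeC (m w)) in h2.
move: h1 h2; clear; case: (E \in _); case: (E == _); lia.
Qed.

Lemma e_m v : v \in U -> e v (m v).
Proof.
move=> vU; rewrite -mem_gedges //; have := mult_path_m (edge v (m v)) vU vU.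
by rewrite eqxx addn1; case: (_ \in _).
Qed.

Lemma m_neq : {in U, forall v, m v != v}.
Proof. by move=> v /e_m; apply: contraTneq => ->; rewrite eirr. Qed.

Lemma mult_path_path E v w : v \in U -> w \in U -> w != v -> w != o v ->
  mult E (P v) + mult E (P w) <= (E \in gedges e).
Proof.
move=> vU wU wv wov; have := wt_le L E; rewrite /wt big_split /=.
have ovU := o_in L vU; have owU := o_in L wU.
have owv : o w != v by apply: contra wov => /eqP <-; rewrite (oK L).
have owov : o w != o v.
  by apply: contra wv => /eqP /(congr1 o); rewrite !(oK L) // => ->.
rewrite (bigD1 v) //= (bigD1 (o v)) ?ovU ?(o_neq L) //=.
rewrite (bigD1 w) ?wU ?wv //= (bigD1 (o w)) ?owU ?owv ?owov ?(o_neq L) //=.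
rewrite !(P_rev L) // !mult_rev; clear; case: (E \in _); lia.
Qed.

Lemma P_trail v : v \in U -> trail e (P v).
Proof. by move=> vU E; apply: leq_trans (mult_path_m E vU vU); rewrite leq_addr. Qed.

Lemma mult_closed E v : v \in U ->
  mult E (closed_walk (P v)) = mult E (P v) + (E == edge (o v) v).
Proof.
move=> vU; rewrite /closed_walk {1 2 3}(P_head L) // mult_rcons.
by rewrite -(P_last v vU) [in RHS](P_head L).
Qed.

Lemma trail_cycle v : v \in U -> trail e (closed_walk (P v)) -> is_gcycle e (P v).
Proof.
move=> vU; rewrite /is_gcycle (P_uniq L) // (P_size L) //.
rewrite (P_head L) //= => /(trail_path esym) ->; move: k3; clear; lia.
Qed.

Lemma close_reduction v : v \in U -> o v = m v -> let U' := U :\ v :\ o v in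
  [/\ linked U' P o m, is_gcycle e (P v) &
      forall E, wt U P m E = wt U' P m E + 2 * mult E (closed_walk (P v))].
Proof.
move=> vU ovm U'; have ovU := o_in L vU; have ovv := o_neq L vU.
have wtE E : wt U P m E = wt U' P m E + 2 * mult E (closed_walk (P v)).
  rewrite mult_closed // /wt (bigD1 v) //= (bigD1 (o v)) ?ovU ?ovv //=.
  rewrite (eq_bigl (fun w => w \in U')) => [|w]; last by rewrite !inE andbC (andbC (w \in U)).
  have mo : m (o v) = v by rewrite ovm (mK L).
  rewrite (P_rev L) // mult_rev mo -ovm (edgeC v); clear; lia.
have sub w : w \in U' -> [/\ w \in U, w != v & w != o v].
  by rewrite !inE => /and3P[].
have U'in w : w \in U -> w != v -> w != o v -> w \in U'.
  by move=> wU wv wov; rewrite !inE wov wv.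
split=> //.
  have [h1 h2 h3 h4 h5 h6 h7 h8 h9 h10] := L.
  split=> [w /sub[wU wv wov]|w /sub[wU _ _]|w /sub[wU _ _]|w /sub[wU wv wov]|
    w /sub[wU _ _]|w /sub[wU _ _]|w /sub[wU _ _]|w /sub[wU _ _]|w /sub[wU _ _]|E].
  - apply: U'in; first exact: h1.
      by apply: contra wov => /eqP <-; rewrite h2.
    by apply: contra wv => /eqP /(congr1 o); rewrite !h2 // => ->.
  - exact: h2.
  - exact: h3.
  - apply: U'in; first exact: h4.
      by apply: contra wov => /eqP E; rewrite ovm -E h5.
    by rewrite ovm; apply: contra wv => /eqP /(congr1 m); rewrite !h5 // => ->.
  - exact: h5.
  - exact: h6.
  - exact: h7.
  - exact: h8.
  - exact: h9.
  - by apply: leq_trans (h10 E); rewrite wtE leq_addr.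
apply: trail_cycle => // E; rewrite mult_closed // ovm edgeC.
exact: mult_path_m.
Qed.

(** With [x = o z], the edge [xz] of [P y] joins the two ends of [P z] and closes it into a
    2k-cycle. In exchange [P y] takes the matching edge [yz] and, rotated, runs from [x] to [o y];
    so only the slots [y] and [z] disappear. *)
Lemma rotate_reduction y z : y \in U -> m y = z -> o y != z ->
  z \in P y -> pred_on z (P y) = o z -> exists P' o',
  [/\ linked (U :\ y :\ z) P' o' m, is_gcycle e (P z) &
      forall E, wt U P m E = wt (U :\ y :\ z) P' m E + 2 * mult E (closed_walk (P z))].
Proof.
move=> yU myz oyz zP px.
set x := o z in px *; set d := o y in oyz *; set R := rotate z (P y).
have zU : z \in U by rewrite -myz (m_in L).
have zy : z != y by rewrite -myz m_neq.
have xU : x \in U := o_in L zU.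
have dU : d \in U := o_in L yU.
have mz : m z = y by rewrite -myz (mK L).
have xz : x != z := o_neq L zU.
have xy : x != y by apply: contra oyz => /eqP E; rewrite /d -E /x (oK L).
have dy : d != y := o_neq L yU.
have xd : x != d.
  by apply: contra zy => /eqP /(congr1 o); rewrite !(oK L) // => ->.
have zs : z \in behead (P y) by move: zP; rewrite (P_head L) // inE (negPf zy).
have RE E : mult E R + (E == edge x z) = mult E (P y) + (E == edge y z).
  by have := mult_rotate E zs zy; rewrite -(P_head L) // px.
pose P' v := if v == x then R else if v == d then rev R else P v.
pose o' v := if v == x then d else if v == d then x else o v.
pose U' := U :\ y :\ z.
have wtE E : wt U P m E = wt U' P' m E + 2 * mult E (closed_walk (P z)).
  rewrite mult_closed // -/x /wt.
  rewrite (bigD1 y) //= (bigD1 z) ?zU //= (bigD1 x) ?xU ?xy ?xz //=.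
  rewrite (bigD1 d) ?dU ?dy ?oyz 1?(eq_sym d) ?xd //=.
  rewrite [in RHS](bigD1 x) ?inE ?xU ?xy ?xz //=.
  rewrite [in RHS](bigD1 d) ?inE ?dU ?dy ?oyz 1?(eq_sym d) ?xd //=.
  rewrite [in RHS](eq_bigl (fun i => (i \in U) && (i != y) && (i != z) && (i != x) && (i != d)));
    last by move=> w; rewrite !inE -!andbA; do !bool_congr; rewrite andbCA; do !bool_congr.
  rewrite [in RHS](eq_bigr (fun w => mult E (P w) + (E == edge w (m w))));
    last by move=> w /andP[/andP[_ /negPf wx] /negPf wd]; rewrite /P' wx wd.
  rewrite /P' eqxx [d == x]eq_sym (negPf xd) eqxx mult_rev.
  have := RE E; have -> : P x = rev (P z) := P_rev L zU.
  have -> : P d = rev (P y) := P_rev L yU.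
  rewrite !mult_rev myz mz (edgeC z y).
  clear; lia.
have sub w : w \in U' -> [/\ w \in U, w != y & w != z].
  by rewrite !inE => /and3P[].
have U'in w : w \in U -> w != y -> w != z -> w \in U'.
  by move=> wU wv wov; rewrite !inE wov wv.
have xU' : x \in U' by apply: U'in.
have dU' : d \in U' by apply: U'in.
have Rsize : size R = 2 * k by rewrite size_rotate (P_size L).
have Runiq : uniq R by rewrite uniq_rotate (P_uniq L).
have Rhead : R = x :: behead R.
  have := head_rotate x zs zy; rewrite -(P_head L) // px -/R.
  by case: (R) Rsize => [|a s] /=; [move: k3; clear; lia | move=> _ ->].
have Rlast a : last a R = d.
  by rewrite last_rotate // P_last.
have revRhead : rev R = d :: behead (rev R).
  have := Rlast x; case/lastP: (R) Rsize => [|s a] /=; first by move: k3; clear; lia.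
  by rewrite rev_rcons last_rcons /= => _ ->.
have [h1 h2 h3 h4 h5 h6 h7 h8 h9 h10] := L.
exists P', o'; split=> //.
  split.
  - move=> w /sub[wU wy wz]; rewrite /o'; case: eqP => // /eqP wx; case: eqP => // /eqP wd.
    apply: U'in; first exact: h1.
      by apply: contra wd => /eqP E; rewrite /d -E h2.
    by apply: contra wx => /eqP E; rewrite /x -E h2.
  - move=> w /sub[wU wy wz]; rewrite /o'; case: (w =P x) => [->|/eqP wx].
      by rewrite eqxx [d == x]eq_sym (negPf xd).
    case: (w =P d) => [->|/eqP wd]; first by rewrite eqxx.
    rewrite ifN; last by apply: contra wz => /eqP E; rewrite -(h2 w) // E /x h2.
    rewrite ifN ?h2 //.
    by apply: contra wy => /eqP E; rewrite -(h2 w) // E /d h2.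
  - move=> w /sub[wU wy wz]; rewrite /o'; case: (w =P x) => [->|/eqP wx].
      by rewrite eq_sym.
    by case: (w =P d) => [->|/eqP wd] //; exact: h3.
  - move=> w /sub[wU wy wz]; apply: U'in; first exact: h4.
      by apply: contra wz => /eqP E; rewrite -myz -E h5.
    by apply: contra wy => /eqP E; rewrite -mz -E h5.
  - by move=> w /sub[wU _ _]; exact: h5.
  - move=> w /sub[wU wy wz]; rewrite /o' /P'; case: (w =P x) => [_|/eqP wx].
      by rewrite eqxx [d == x]eq_sym (negPf xd).
    case: (w =P d) => [_|/eqP wd]; first by rewrite eqxx revK.
    rewrite ifN; last by apply: contra wz => /eqP E; rewrite -(h2 w) // E /x h2.
    rewrite ifN ?h6 //.
    by apply: contra wy => /eqP E; rewrite -(h2 w) // E /d h2.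
  - move=> w /sub[wU _ _]; rewrite /P'; case: ifP => // _; case: ifP => _; last exact: h7.
    by rewrite size_rev.
  - move=> w /sub[wU _ _]; rewrite /P'; case: ifP => // _; case: ifP => _; last exact: h8.
    by rewrite rev_uniq.
  - move=> w /sub[wU _ _]; rewrite /P'; case: eqP => [->|_] //; case: eqP => [->|_] //.
    exact: h9.
  - by move=> E; apply: leq_trans (h10 E); rewrite wtE leq_addr.
apply: trail_cycle => // E; rewrite mult_closed // -/x.
apply: leq_trans (mult_path_path E zU yU _ _); last 2 first.
- by rewrite eq_sym.
- by rewrite eq_sym.
by rewrite leq_add2l -px (P_head L) //; apply: pred_on_edge; rewrite -?(P_head L).
Qed.

End Facts.

End Linked.

(** * Instances without reduction *)

Section Irreducible.
Variables (T : finType) (e : rel T) (k : nat).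
Hypotheses (esym : symmetric e) (eirr : irreflexive e) (k3 : 3 <= k).
Hypothesis eg : girth_at_least e (2 * k - 2).
Variables (U : {set T}) (P : T -> seq T) (o m : T -> T).
Hypothesis L : linked e k U P o m.
Implicit Types (v w x y z a b : T) (E : {set T}).

(* By the girth condition [a] and [b] are among the last three vertices of
   [P v], and they are not adjacent because there is no triangle. *)
Lemma chords_meet_last v a b : v \in U -> a \in P v -> b \in P v -> a != b ->
  trail e (a :: P v) -> trail e (b :: P v) -> a != o v -> b != o v -> False.
Proof.
move=> vU aP bP ab ta tb ao bo.
have PE := P_head L vU; have Ps := P_size L vU; have Pu := P_uniq L vU.
have idx c : c \in P v -> trail e (c :: P v) -> c != o v -> 
  index c (P v) = 2 * k - 3 \/ index c (P v) = 2 * k - 2.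
  move=> cP tc co; have := back_edge esym eirr eg tc Pu cP.
  have := cP; rewrite -index_mem Ps.
  have : index c (P v) != (2 * k).-1.
    by apply: contra co => /eqP E; rewrite -(P_last L v vU) -nth_last Ps -E nth_index.
  by move: k3; clear; lia.
have va : e v a by rewrite esym; move: ta; rewrite PE; exact: trail_edge.
have vb : e v b by rewrite esym; move: tb; rewrite PE; exact: trail_edge.
have step c d : c \in P v -> d \in P v -> index d (P v) = (index c (P v)).+1 -> e c d.
  move=> cP dP icd; have := P_trail esym eirr L vU; rewrite PE => /(trail_path esym) /pathP H.
  have := H v (index c (P v)).
  rewrite -PE nth_index // -[nth v (behead _) _]/(nth v (v :: behead (P v)) _.+1) -PE -icd.
  rewrite nth_index //; apply; rewrite size_behead icd.
  by have := dP; rewrite -index_mem icd Ps; clear; lia.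
have ne : index a (P v) <> index b (P v).
  by move=> E; case/eqP: ab; rewrite -(nth_index v aP) E nth_index.
have g3 : 3 < 2 * k - 2 by move: k3; clear; lia.
have eab : e a b || e b a.
  case: (idx a aP ta ao) => Ia; case: (idx b bP tb bo) => Ib;
    first [by case: ne; rewrite Ia Ib | apply/orP].
  - left; apply: step => //; move: k3 Ia Ib; clear; lia.
  - right; apply: step => //; move: k3 Ia Ib; clear; lia.
have {}eab : e a b by case/orP: eab => //; rewrite esym.
by apply: (no_triangle eirr eg g3 va eab); rewrite esym.
Qed.

Lemma m_cons_trail v : v \in U -> trail e (m v :: P v).
Proof.
move=> vU E; rewrite (P_head L) // mult_cons2 edgeC addnC -(P_head L) //.
exact (mult_path_m esym eirr L E vU vU).
Qed.

(** The edge into [z] lies on [P y], hence not on [P v]; it can be prepended to [P v] when [v] is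
    one of its ends. *)
Lemma pred_cons_trail y z v : y \in U -> v \in U -> v != y -> v != o y ->
  z \in P y -> z != y -> 
  (v = z -> trail e (pred_on z (P y) :: P v)) /\
  (v = pred_on z (P y) -> trail e (z :: P v)).
Proof.
move=> yU vU vy voy zP zy.
have H E : (E == edge (pred_on z (P y)) z) + mult E (P v) <= (E \in gedges e).
  apply: leq_trans (mult_path_path L E yU vU vy voy); rewrite leq_add2r.
  rewrite (P_head L yU); apply: pred_on_edge => //.
  by move: zP; rewrite {1}(P_head L yU) inE (negPf zy).
split=> vE E; rewrite (P_head L vU) mult_cons2 -(P_head L vU); have := H E.
  by rewrite vE.
by rewrite edgeC vE.
Qed.

Lemma pred_on_neq y z : y \in U -> z \in P y -> z != y -> 
  pred_on z (P y) != z /\ pred_on z (P y) != o y.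
Proof.
move=> yU zP zy; rewrite -(P_last L y yU).
have Pu := P_uniq L yU; have := zP; rewrite {1}(P_head L yU) inE (negPf zy) /=.
move=> /splitat [p1 [p2 [E H]]]; have H' : z \notin y :: p1 by rewrite inE negb_or zy.
move: Pu; rewrite (P_head L yU) E -cat_cons cat_uniq pred_onE // => /and3P[_ /hasPn N _].
split; first by apply: contraNneq H' => zE; rewrite -[X in X \in _]zE; exact: (mem_last y p1).
rewrite last_cat /=; apply: contraL (mem_last y p1) => /eqP ->.
exact: N (mem_last z p2).
Qed.

Hypothesis noclose : {in U, forall v, o v != m v}.
Hypothesis norot : {in U, forall y, m y \in P y -> pred_on (m y) (P y) != o (m y)}.

(** Two edges at [m y] lie off [P (m y)]: those to [y] and to the predecessor of [m y] on [P y].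
    [noclose] and [norot] keep both away from the far end, so by [chords_meet_last] they cannot both
    return to the path, and the first one does. *)
Lemma pred_notin y : y \in U -> m y \in P y -> y \in P (m y) ->
  pred_on (m y) (P y) \notin P (m y).
Proof.
move=> yU zP yP; have zU := m_in L yU; have zy := m_neq esym eirr L yU.
have mz : m (m y) = y := mK L yU.
have zoy : m y != o y by rewrite eq_sym noclose.
apply/negP => xP.
have xy : pred_on (m y) (P y) != y.
  apply/eqP => xE; have := mult_path_m esym eirr L (edge y (m y)) yU yU.
  have := @pred_on_edge _ (edge y (m y)) (m y) y (behead (P y)).
  rewrite -(P_head L) // xE eqxx => /(_ _ zy) H.
  have : 0 < mult (edge y (m y)) (P y).
    by apply: H; move: zP; rewrite {1}(P_head L yU) inE (negPf zy).
  by case: (_ \in gedges _); move: (mult _ _); clear; lia.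
apply: (chords_meet_last zU xP yP xy _ _ (norot yU zP)).
- exact: (pred_cons_trail yU zU zy zoy zP zy).1.
- by have := m_cons_trail zU; rewrite mz.
- by have := noclose zU; rewrite mz eq_sym.
Qed.

(** The same argument at [x]: the matching edge to [o z] and the freed edge to [z] are off [P x],
    and the first returns to it. *)
Lemma pred_path_notin z (y := m z) (x := m (o z)) : z \in U -> z \in P y ->
  pred_on z (P y) = x -> x != y -> o z \in P x -> z != o x -> z \notin P x.
Proof.
move=> zU zP px xy ozP zox; apply/negP => zPx.
have yU : y \in U := m_in L zU; have ozU := o_in L zU; have xU : x \in U := m_in L ozU.
have zy : z != y by rewrite eq_sym; exact (m_neq esym eirr L zU).
have mx : m x = o z := mK L ozU.
have [xz xoy] := pred_on_neq yU zP zy; rewrite px in xz xoy.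
apply: (chords_meet_last xU ozP zPx (o_neq L zU) _ _ _ zox).
- by rewrite -mx; exact: m_cons_trail.
- by apply: (pred_cons_trail yU xU xy xoy zP zy).2.
- by apply: contra xz => /eqP /(congr1 o); rewrite !(oK L) // => ->.
Qed.

(* Orient every matching edge by the colouring [c]: [z] with [~~ c z] and
   [y = m z].  If [y] is not on [P z], prepend [y] to [P z]; if [z] is not on
   [P y], prepend [z] to [P y]; otherwise rotate [P y] along [yz], which frees
   the edge [xz] with [x] the predecessor of [z] on [P y], and prepend [x] to
   [P z].  In the last case the path [P z] may already receive [x] at its other
   end [o z = m x]; then [z] is prepended to [P x] instead ([clash]), which
   amounts to exchanging the roles of the coinciding ends of the slots [x], [y]. *)
Lemma irreducible_good : exists D, good e k (wt U P m) D.
Proof.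
have mn := m_neq esym eirr L.
have [c [co cm]] := bicolouring (o_in L) (oK L) (o_neq L) (m_in L) (mK L) mn.
have [oU oKU mU mKU] := And4 (o_in L) (oK L) (m_in L) (mK L).
pose inn v := m v \in P v.
pose both v := inn v && inn (m v).
pose px v := pred_on (m v) (P v).
pose clash z := [&& both z, px (m z) == m (o z), inn (m (o z)) & ~~ inn (o z)].
pose R v := if both v then rotate (m v) (P v) else P v.
pose P' v := if c v then R v else rev (R (o v)).
pose en v := if c v && both v then px v else v.
pose swapped v := if c v then clash (m v) else clash (o (m v)).
(* In a clash the slots [y] and [x = m (o z)] both end at the vertex [x]; exchanging them keeps all
   ends ([enth]) and changes only the partners. *)
pose th v := if swapped v then m (o (m v)) else v.
(* Before the exchange by [th]: the slot without colour [c] is extended by default. Its partner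
   takes over if only the partner's path can receive the matching edge, or in a clash. *)
pose X1 v := if c v then inn (m v) && ~~ inn v || clash (m v)
             else ~~ (inn v && ~~ inn (m v) || clash v).
have thU : {in U, forall v, th v \in U}.
  by move=> v vU; rewrite /th; case: ifP => // _; rewrite mU // oU // mU.
have cmom : {in U, forall v, c (m (o (m v))) = ~~ c v}.
  by move=> v vU; rewrite cm ?oU ?mU // co ?mU // cm // negbK.
have mom : {in U, forall v, m (o (m (m (o (m v))))) = v}.
  by move=> v vU; rewrite (mKU (o (m v))) ?oU ?mU // oKU ?mU // mKU.
have thK : {in U, involutive th}.
  move=> v vU; rewrite /th; have [sv|/negPf-> //] := boolP (swapped v).
  rewrite ifT ?mom //; move: sv; rewrite /swapped cmom //; case: (c v) => /=.
    by rewrite mKU ?oU ?mU // oKU ?mU.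
  by rewrite mKU ?oU ?mU.
have bothm : {in U, forall v, both (m v) = both v}.
  by move=> v vU; rewrite /both mKU // andbC.
have enth : {in U, forall v, en (th v) = en v}.
  move=> v vU; rewrite /th; case: ifP => //; rewrite /swapped /en cmom //.
  case: (c v) => /= /and4P[bz /eqP px_z _ _].
    by rewrite -bothm // bz -px_z mKU.
  by rewrite bothm ?oU ?mU // bz px_z oKU ?mKU ?mU.
have enF : {in U, forall v, ~~ c v -> en v = v}.
  by move=> v vU cv; rewrite /en (negPf cv).
have RP v : R v =i P v by move=> w; rewrite /R; case: ifP => // _; exact: mem_rotate.
have P'P : {in U, forall v, P' v =i P v}.
  move=> v vU w; rewrite /P'; case: ifP => _; first exact: RP.
  by rewrite mem_rev RP (P_rev L) // mem_rev.
have behP v w : v \in U -> w \in P v -> w != v -> w \in behead (P v).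
  by move=> vU; rewrite {1}(P_head L) // inE => + /negPf wv; rewrite wv.
(* A rotation puts [yz] on the path and frees [xz], which is now the edge between the ends of the
   slots [y] and [z]; the total is unchanged. *)
have wtE E : \sum_(v in U) (mult E (P' v) + (E == edge (en v) (en (th (m (th v)))))) = wt U P m E.
  rewrite /wt !big_split /=.
  have -> : \sum_(v in U) (E == edge (en v) (en (th (m (th v)))))
    = \sum_(v in U) (E == edge (en v) (en (m v))).
    rewrite (reindex_onto th th) /= => [|v vU]; last exact: thK.
    rewrite (eq_bigl (fun v => v \in U)) => [|v].
      by apply: eq_bigr => v vU; rewrite thK // !enth // mU.
    apply/andP/idP => [[tv /eqP <-]|vU]; first exact: thU.
    by rewrite thU // thK.
  rewrite !(sum_pair oU oKU co (fun v => mult E _)) !(sum_pair mU mKU cm (fun v => (E == _) : nat)).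
  rewrite -!big_split /=; apply: eq_bigr => v /andP[vU cv].
  rewrite (P_rev L) // /P' co // cv /= oKU // !mult_rev mKU //.
  rewrite (enF (m v)) ?mU ?cm ?cv // /en cv /= !(edgeC (m v)) /R.
  case: ifP => // /andP[iv _].
  have := mult_rotate E (behP v (m v) vU iv (mn v vU)) (mn v vU).
  rewrite -(P_head L) // -/(px v); clear; lia.
have X1m : {in U, forall v, X1 (m v) = ~~ X1 v}.
  by move=> v vU; rewrite /X1 cm //; case: (c v); rewrite /= ?mKU ?negbK.
have Xcases : {in U, forall v, X1 (th v) -> 
  [\/ [/\ c v, en (th (m (th v))) = m v, inn (m v) & ~~ inn v],
      [/\ ~~ c v, ~~ inn v & en (th (m (th v))) = m v],
      [/\ ~~ c v, both v, ~~ clash v & en (th (m (th v))) = px (m v)] |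
      [/\ ~~ c v, clash (o (m v)) & en (th (m (th v))) = o (m v)]]}.
  move=> v vU; rewrite enth ?mU ?thU //; rewrite /th; case: ifP => sv.
    move: sv; rewrite /swapped /X1 cmom //; case: ifP => cv.
      by case/and4P=> _ _ i1 i2; rewrite /= mKU ?oU ?mU // i1 i2.
    move=> cl _; constructor 4; split=> //.
    by rewrite mKU ?oU ?mU // enF ?oU ?mU // co ?mU // cm // cv.
  move: sv; rewrite /swapped /X1 {2 4}/en; case: ifP => cv sv; rewrite ?sv ?orbF.
    by case/andP=> i1 i2; constructor 1; rewrite enF ?mU // cm // cv.
  rewrite negb_or negb_and negbK => /andP[+ ncl].
  have [iv /= imv|niv _] := boolP (inn v).
    by constructor 3; split=> //; rewrite /both ?iv ?imv // /en cm // cv bothm // /both iv imv.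
  by constructor 2; split=> //; rewrite /en cm // cv bothm // /both (negPf niv).
have Xnotin : {in U, forall v, X1 (th v) -> en (th (m (th v))) \notin P' v}.
  move=> v vU /(Xcases v vU); rewrite P'P //; case=> [[_ -> _]|[_ niv ->]|[_ bv _ ->]|[cv + ->]] //.
    have /andP[iv imv] := bv.
    have := pred_notin (mU v vU); rewrite /px (mKU v vU) => H; apply: H => //.
    by move: imv; rewrite /inn mKU.
  have zU : o (m v) \in U by rewrite oU // mU.
  have xE : m (o (o (m v))) = v by rewrite oKU ?mKU ?mU.
  case/and4P=> /andP[iz imz] /eqP px_z ix niz.
  have := pred_path_notin zU; rewrite xE; apply.
  - by move: imz; rewrite /inn mKU.
  - by move: px_z; rewrite /px mKU // xE.
  - apply/eqP => /(congr1 m); rewrite mKU ?oU ?mU // => vE.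
    by have /eqP := o_neq L (mU v vU); apply.
  - by move: ix; rewrite xE /inn oKU ?mU.
  - by apply/eqP => /(congr1 c); rewrite !co ?mU // cm // (negPf cv).
(* In the third case of [Xcases] a coincidence would be exactly a [clash], which that case
   excludes. *)
have Xneq0 : {in U, forall v, ~~ c v -> X1 (th v) -> X1 (th (o v)) ->
    en (th (m (th v))) != en (th (m (th (o v))))}.
  move=> v vU cv Xv /(Xcases _ (oU v vU)); rewrite co // cv.
  case=> [[_ -> imw niw]|[]|[]|[]] //.
  case: (Xcases v vU Xv) => [[]|[_ niv ->]|[_ bv ncl ->]|[_ cl ->]]; first by rewrite (negPf cv).
  - apply: contra (o_neq L vU) => /eqP /(congr1 m); rewrite !mKU ?oU // => {2}->.
    exact: eqxx.
  - by apply: contra ncl => pxE; rewrite /clash bv pxE imw niw.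
  - apply: contra niw => /eqP zE; move: cl => /and4P[/andP[_ imz] _ _ _].
    by move: imz; rewrite zE mKU ?oU.
have Xneq : {in U, forall v, X1 (th v) -> X1 (th (o v)) ->
    en (th (m (th v))) != en (th (m (th (o v))))}.
  move=> v vU Xv Xov; have [cv|cv] := boolP (c v); last exact: Xneq0.
  by have := Xneq0 (o v) (oU v vU); rewrite co // cv oKU // eq_sym; apply.
have [D [[D1 D2] D3 D4 D5 D6]] : exists D : seq (piece T),
  [/\ all (piece_valid e) D /\ all (@is_path_piece T) D,
      all (fun d => piece_length d \in [:: 2 * k - 1; 2 * k; 2 * k + 1]) D,
      forall v, k_balanced_at k D v,
      count (fun d => is_path_piece d && (piece_length d == 2 * k - 1)) D =
      count (fun d => is_path_piece d && (piece_length d == 2 * k + 1)) D &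
      forall E, 2 * \sum_(d <- D) piece_mult E d =
        \sum_(v in U) (mult E (P' v) + (E == edge (en v) (en (th (m (th v))))))].
  apply: (@attach _ e k _ U P' en o (fun v => th (m (th v))) c (fun v => X1 (th v))) => //.
  - by move: k3; clear; lia.
  - by move=> v vU; rewrite thU // mU // thU.
  - by move=> v vU; rewrite thK ?mU ?thU // mKU ?thU // thK.
  - by move=> v vU; rewrite thK ?mU ?thU // X1m // thU.
  - by move=> v vU; rewrite /P' co //; case: (c v) => /=; rewrite ?oKU ?revK.
  - move=> v vU; rewrite /P' /R; case: (c v); rewrite ?size_rev; case: ifP => _;
      by rewrite ?size_rotate (P_size L) // oU.
  - move=> v vU; rewrite /P' /R; case: (c v); rewrite ?rev_uniq; case: ifP => _;
      by rewrite ?uniq_rotate (P_uniq L) // oU.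
  - move=> v vU; rewrite /P' /en; case: ifP => cv /=.
      rewrite /R; have [bv|_] := boolP (both v); last exact: (P_head L vU).
      have /andP[iv _] := bv; have := head_rotate v (behP v (m v) vU iv (mn v vU)) (mn v vU).
      rewrite -(P_head L) // -/(px v); have := size_rotate (m v) (P v).
      rewrite (P_size L) //; case: (rotate _ _) => [/= sz|a s _ /= -> //].
      by exfalso; move: k3 sz; clear; lia.
    have Rl : last v (R (o v)) = v.
      rewrite /R; case: ifP => [/andP[iv _]|_]; last by rewrite (P_last L) ?oKU ?oU.
      by rewrite last_rotate // (P_last L) ?oKU ?oU.
    have : v \in R (o v) by rewrite RP (P_rev L) // mem_rev (P_head L) // inE eqxx.
    by move: Rl; case/lastP: (R (o v)) => [|s a] //; rewrite last_rcons rev_rcons => ->.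
  - by move=> E; rewrite wtE; exact: (wt_le L E).
exists D; split=> //; last by move=> E; rewrite D6 wtE.
by apply: sub_all D2 => d ->.
Qed.

End Irreducible.

(** Each reduction takes two vertices out of [U], whence induction on [#|U|]; when none applies, the
    failed tests are [noclose] and [norot]. *)
Lemma linked_good (T : finType) (e : rel T) k (U : {set T}) P o m :
  symmetric e -> irreflexive e -> 3 <= k -> girth_at_least e (2 * k - 2) ->
  linked e k U P o m -> exists D, good e k (wt U P m) D.
Proof.
move=> esym eirr k3 eg; move: {2}#|U| (leqnn #|U|) => n.
elim: n U P o => [|n IH] U P o Un L.
  exists [::]; split=> // E; rewrite big_nil /wt big1 // => v.
  by rewrite (cards0_eq (eqP (_ : #|U| == 0))) ?inE // -leqn0.
have [/existsP[v /andP[vU /eqP ov]]|] := boolP [exists v, (v \in U) && (o v == m v)].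
  have [L' cyc wtE] := close_reduction esym eirr k3 L vU ov.
  have [|D goodD] := IH _ _ _ _ L'.
    rewrite -ltnS; apply: leq_trans Un; apply/proper_card/properP.
    split; first by rewrite !subDset; apply/subsetP => w wU; rewrite !inE wU !orbT.
    by exists v; rewrite // !inE eqxx andbF.
  exists (PCycle (P v) :: D); apply: good_cycle goodD => //; exact: (P_size L).
rewrite negb_exists => /forallP noclose.
have {}noclose : {in U, forall v, o v != m v}.
  by move=> v vU; have := noclose v; rewrite vU.
have [/existsP[y /and3P[yU mP /eqP pE]]|] :=
    boolP [exists y, [&& y \in U, m y \in P y & pred_on (m y) (P y) == o (m y)]].
  have [P' [o' [L' cyc wtE]]] :=
    rotate_reduction esym eirr k3 L yU (erefl _) (noclose y yU) mP pE.
  have [|D goodD] := IH _ _ _ _ L'.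
    rewrite -ltnS; apply: leq_trans Un; apply/proper_card/properP.
    split; first by rewrite !subDset; apply/subsetP => w wU; rewrite !inE wU !orbT.
    by exists y; rewrite // !inE eqxx andbF.
  exists (PCycle (P (m y)) :: D); apply: good_cycle goodD => //.
  by rewrite (P_size L) // (m_in L).
rewrite negb_exists => /forallP norot.
apply: (irreducible_good esym eirr k3 eg L noclose) => y yU mP.
by have := norot y; rewrite yU mP.
Qed.

(** * Factorisation into permutations *)

Section Assignment.
Variables (I T : finType) (R : I -> T -> bool).
Implicit Types (f : I -> T) (t u : T).

Definition load f t := #|[set i | f i == t]|.

Lemma loadE f t : load f t = \sum_i (f i == t).
Proof. by rewrite /load -sum1dep_card big_mkcond; apply: eq_bigr => i _; case: eqP. Qed.

Lemma sum_load f (A : {set T}) : \sum_(t in A) load f t = #|[set i | f i \in A]|.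
Proof.
under eq_bigr do rewrite loadE; rewrite exchange_big -sum1dep_card [RHS]big_mkcond /=.
apply: eq_bigr => i _; case: ifP => fiA.
  by rewrite (bigD1 (f i)) //= eqxx big1 // => t /andP[_]; rewrite eq_sym => /negPf->.
by rewrite big1 // => t tA; case: eqP => // E; rewrite E tA in fiA.
Qed.

Lemma load_shift f t p : (forall i, R i (f i)) ->
  path (fun t u => [exists i, (f i == t) && R i u]) t p -> uniq (t :: p) ->
  exists f', [/\ forall i, R i (f' i), forall i, f i \notin t :: p -> f' i = f i &
    forall u, load f' u + (u == t) = load f u + (u == last t p)].
Proof.
move=> Rf; elim: p t => [|u p IH] t /=; first by exists f.
case/andP=> /existsP[i /andP[/eqP fi Riu]] pP /andP[tup up].
have [f' [Rf' f'E loadE']] := IH u pP up.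
exists (fun j => if j == i then u else f' j); split.
- by move=> j; case: eqP => [->|].
- move=> j; rewrite inE negb_or => /andP[fjt fjp].
  by case: eqP => [ji|_]; [rewrite ji fi eqxx in fjt | exact: f'E].
move=> w; have f'i : f' i = t by rewrite f'E fi.
suff : load (fun j => if j == i then u else f' j) w + (t == w) = load f' w + (u == w).
  have := loadE' w; rewrite (eq_sym u) (eq_sym t); by move=> <-.
rewrite !loadE (bigD1 i) //= [in RHS](bigD1 i) //= eqxx f'i.
rewrite [X in _ + X + _](@eq_bigr _ _ _ _ _ _ _ (fun j => (f' j == w) : nat)) => [|j /negPf->] //.
clear; lia.
Qed.

Variables (a d : nat).
Hypotheses (a_gt0 : 0 < a) (Ra : forall i, #|[set t | R i t]| = a)
  (Rd : forall t, #|[set i | R i t]| = a * d).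

(** Double counting of admissible pairs: items assigned into [A] have all their [a] targets in [A],
    and each target admits [a * d] items. So at most [d * #|A|] items are assigned into [A]. *)
Lemma saturated_load f (A : {set T}) t : (forall i, R i (f i)) ->
  (forall i u, f i \in A -> R i u -> u \in A) ->
  (forall u, u \in A -> d <= load f u) -> t \in A -> load f t <= d.
Proof.
move=> Rf Acl Ad tA; rewrite leqNgt; apply/negP => td.
have : d * #|A| < #|[set i | f i \in A]|.
  rewrite -sum_load mulnC -sum_nat_const (bigD1 t) // [X in _ < X](bigD1 t) //= -addSn.
  by rewrite leq_add // leq_sum // => u /andP[uA _]; rewrite Ad.
rewrite ltnNge => /negP; apply; rewrite -(leq_pmul2l a_gt0).
have -> : a * #|[set i | f i \in A]| = \sum_(i | f i \in A) \sum_(u in A) R i u.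
  rewrite -sum1dep_card big_distrr /=; apply: eq_bigr => i fiA.
  rewrite muln1 -(Ra i) -sum1dep_card big_mkcond [RHS]big_mkcond; apply: eq_bigr => u _.
  by case: ifP => Riu; [rewrite (Acl i u) // Riu | case: ifP].
rewrite exchange_big /= mulnA mulnC -sum_nat_const; apply: leq_sum => u _.
rewrite -(Rd u) -sum1dep_card [X in X <= _]big_mkcond [X in _ <= X]big_mkcond /=.
by apply: leq_sum => i _; case: ifP => // _; case: (R i u).
Qed.

(** A Hall-type theorem, used with [a = 2] to orient edges and with [d = 1] to find perfect
    matchings in regular bipartite graphs. An overloaded target reaches an underloaded one, or its
    reachable set contradicts [saturated_load]. *)
Lemma balanced_assignment :
  exists f, (forall i, R i (f i)) /\ forall t, load f t = d.
Proof.
pose excess f := \sum_t (load f t - d).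
have [f0 Rf0] : exists f, forall i, R i (f i).
  have ex i : exists t, R i t.
    by have := a_gt0; rewrite -(Ra i) => /card_gt0P[t]; rewrite inE; exists t.
  by exists (fun i => xchoose (ex i)) => i; exact: xchooseP (ex i).
have : exists f, (forall i, R i (f i)) /\ forall t, load f t <= d.
  have [n] := ubnP (excess f0); elim: n f0 Rf0 => // n IH f Rf fn.
  have [/forallP|] := boolP [forall t, load f t <= d]; first by exists f.
  rewrite negb_forall => /existsP[t]; rewrite -ltnNge => td.
  pose arc t u := [exists i, (f i == t) && R i u].
  pose A := [set u | connect arc t u].
  have [/existsP[u /andP[]]|] := boolP [exists u, (u \in A) && (load f u < d)].
    rewrite inE => /connectP[p pP ->]; case/shortenP: pP => q qP uq _ ld.
    have [f' [Rf' _ loadE']] := load_shift Rf qP uq.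
    apply: (IH f' Rf'); apply: leq_trans (fn : excess f <= n).
    have tl : (t == last t q) = false.
      by apply/eqP => E; move: ld td; rewrite -E; clear; lia.
    rewrite /excess (bigD1 t) // [X in _ < X](bigD1 t) //= -addSn leq_add //.
      by have := loadE' t; rewrite eqxx tl; move: td; clear; lia.
    apply: leq_sum => w /negPf wt; have := loadE' w; rewrite wt.
    by case: eqP => [->|_]; rewrite addn0 => ->; move: ld; rewrite ?addn0 ?addn1 => // ld; rewrite (eqP (ld : _.+1 - d == 0)) leq0n.
  rewrite negb_exists => /forallP nd; exfalso.
  suff : load f t <= d by move: td; clear; lia.
  apply: (@saturated_load f A) => //.
  - move=> i u; rewrite !inE => ci Riu; apply: connect_trans ci (connect1 _).
    by apply/existsP; exists i; rewrite eqxx.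
  - by move=> u uA; have := nd u; rewrite uA /= -leqNgt.
  - by rewrite inE connect0.
case=> f [Rf fd]; exists f; split=> //.
(* Since the number of items is [d * #|T|], loads of at most [d] must all equal [d]. *)
have cI : #|I| = d * #|T|.
  apply/eqP; rewrite -(eqn_pmul2l a_gt0) -!sum1_card; apply/eqP.
  transitivity (\sum_i \sum_t (R i t : nat)).
    rewrite big_distrr; apply: eq_bigr => i _; rewrite /= muln1 -(Ra i) -sum1dep_card.
    by rewrite big_mkcond; apply: eq_bigr => t _; case: (R i t).
  rewrite exchange_big !big_distrr /=; apply: eq_bigr => t _; rewrite /= muln1 -(Rd t).
  by rewrite -sum1dep_card [RHS]big_mkcond; apply: eq_bigr => i _; case: (R i t).
have := sum_load f setT; rewrite (_ : [set i | _] = setT); last by apply/setP => i; rewrite !inE.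
rewrite cardsT cI => sl t; apply/eqP; rewrite eqn_leq fd leqNgt; apply/negP => lt.
suff : \sum_(t in [set: T]) load f t < d * #|T| by rewrite sl ltnn.
rewrite mulnC -cardsT -sum_nat_const (bigD1 t) // [X in _ < X](bigD1 t) //= -addSn.
by rewrite leq_add // leq_sum.
Qed.

End Assignment.

Section Factorisation.
Variable T : finType.
Implicit Types (x y z : T) (g : rel T) (d : nat).

Lemma edge_injr x : injective (edge x).
Proof.
move=> y z /eqP; rewrite edge_eq eqxx => /orP[/eqP //|/andP[/eqP -> /eqP //]].
Qed.

(** Each edge is an item choosing one of its ends as tail; load [d] is outdegree [d], and the rest
    of the degree is the indegree. *)
Lemma regular_orientation g d : symmetric g -> irreflexive g -> regular g (2 * d) ->
  exists a : rel T, [/\ forall x y, a x y + a y x = g x y,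
    forall x, #|[set y | a x y]| = d & forall y, #|[set x | a x y]| = d].
Proof.
move=> gsym girr gd; pose I := {E : {set T} | E \in gedges g}.
pose R (i : I) x := x \in val i.
have R2 i : #|[set t | R i t]| = 2.
  rewrite (_ : [set t | R i t] = val i); last by apply/setP => t; rewrite inE.
  case: i => E /= /(gedgesP gsym)[x [y [gxy ->]]]; rewrite cards2.
  by rewrite (_ : x != y) //; apply: contraTneq gxy => ->; rewrite girr.
have Rd x : #|[set i | R i x]| = 2 * d.
  rewrite -(gd x) /degree -(card_imset _ val_inj) -[RHS](card_imset _ (@edge_injr x)).
  apply: eq_card => E; apply/imsetP/imsetP.
    case=> [[E' E'g]]; rewrite inE /R /= => xE ->; case/(gedgesP gsym): (E'g) => u [v [guv E'E]].
    move: xE; rewrite E'E in_set2 => /orP[] /eqP xE.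
      by exists v; rewrite ?inE xE.
    by exists u; rewrite ?inE xE 1?gsym // edgeC.
  case=> y; rewrite inE => gxy ->; have Eg : edge x y \in gedges g by rewrite mem_gedges.
  by exists (exist _ (edge x y) Eg); rewrite ?inE /R //= set21.
have [f [Rf fd]] := balanced_assignment (isT : 0 < 2) R2 Rd.
pose a x y := [exists i : I, (val i == edge x y) && (f i == x)].
have aE x y : a x y + a y x = g x y.
  have [gxy|ngxy] := boolP (g x y); last first.
    rewrite -mem_gedges // in ngxy.
    have nE u v : edge u v = edge x y -> a u v = false.
      move=> uv; apply/existsP => -[[E /= Eg] /andP[/eqP EE _]].
      by rewrite EE uv (negPf ngxy) in Eg.
    by rewrite !nE // edgeC.
  have Eg : edge x y \in gedges g by rewrite mem_gedges.
  pose i0 : I := exist _ (edge x y) Eg.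
  have aE u v : edge u v = edge x y -> a u v = (f i0 == u).
    move=> uv; apply/existsP/idP => [[i /andP[/eqP iE /eqP <-]]|fu].
      by apply/eqP; congr f; apply: val_inj; rewrite iE uv.
    by exists i0; rewrite fu uv /= eqxx.
  have xy : x != y by apply: contraTneq gxy => ->; rewrite girr.
  rewrite !aE //; last exact: edgeC.
  have := Rf i0; rewrite /R /= in_set2.
  by case: (f i0 =P x) => [->|_] /=; [rewrite (negPf xy) | move=> ->].
have out x : #|[set y | a x y]| = d.
  rewrite -(fd x) /load -(card_imset _ val_inj) -[LHS](card_imset _ (@edge_injr x)).
  apply: eq_card => E; apply/imsetP/imsetP.
    by case=> y; rewrite inE => /existsP[i /andP[/eqP iE fi]] ->; exists i; rewrite ?inE.
  case=> i; rewrite inE => /eqP fi ->; have := Rf i; rewrite /R fi => xi.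
  case/(gedgesP gsym): (valP i) => u [v [guv iE]].
  move: xi; rewrite iE in_set2 => /orP[] /eqP xE.
    by exists v; rewrite ?xE //= inE; apply/existsP; exists i; rewrite iE fi xE !eqxx.
  exists u; rewrite ?xE 1?edgeC //= inE; apply/existsP; exists i.
  by rewrite iE fi xE edgeC !eqxx.
exists a; split=> // x; apply/eqP; rewrite -(eqn_add2l #|[set y | a x y]|) {2}out.
rewrite addnn -mul2n -(gd x) /degree -!sum1dep_card.
rewrite [X in X + _]big_mkcond [X in _ + X]big_mkcond [X in _ == X]big_mkcond -big_split /=.
by apply/eqP/eq_bigr => y _; have := aE x y; case: (a x y); case: (a y x); case: (g x y).
Qed.

Lemma perm_decomposition d (a : rel T) :
  (forall x, #|[set y | a x y]| = d) -> (forall y, #|[set x | a x y]| = d) ->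
  exists ps : seq {perm T}, size ps = d /\
    forall x y, \sum_(p <- ps) (p x == y) = a x y.
Proof.
elim: d a => [|d IH] a ao ai.
  exists [::]; split=> // x y; rewrite big_nil.
  by have /cards0_eq/setP/(_ y) := ao x; rewrite !inE => ->.
have ai1 y : #|[set x | a x y]| = d.+1 * 1 by rewrite muln1.
have [f [af f1]] := balanced_assignment (isT : 0 < d.+1) ao ai1.
have fE y : exists x, [set z | f z == y] = [set x] by apply/cards1P/eqP/f1.
have finj : injective f.
  move=> x y fxy; have [z /setP zE] := fE (f y).
  by have := zE x; have := zE y; rewrite !inE fxy eqxx => /esym/eqP-> /esym/eqP.
have [||ps [sps psE]] := IH (fun x y => a x y && (f x != y)).
- move=> x; apply/eqP; rewrite -eqSS -(ao x) (cardsD1 (f x) [set y | a x y]) in_set af add1n eqSS.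
  by apply/eqP/eq_card => y; rewrite !inE andbC eq_sym.
- move=> y; have [x /setP xE] := fE y; apply/eqP; rewrite -eqSS -(ai y).
  have fx : f x = y by have := xE x; rewrite !inE eqxx => /eqP.
  rewrite (cardsD1 x [set x | a x y]) in_set -[X in a x X]fx af add1n eqSS.
  by apply/eqP/eq_card => z; rewrite !inE andbC; have := xE z; rewrite !inE => ->.
exists (perm finj :: ps); split=> [|x y]; first by rewrite /= sps.
rewrite big_cons psE permE; case: (f x =P y) => [<-|_] //=; first by rewrite af.
by rewrite andbT.
Qed.

End Factorisation.

(** * Growing paths along permutations *)

Section Linkage.
Variable T : finType.
Implicit Types (x y t w : T) (E : {set T}) (p : {perm T}).

Definition arcs E (f : T -> T) := \sum_t (E == edge t (f t)).

Lemma arcsE x y f : x != y -> arcs (edge x y) f = (f x == y) + (f y == x).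
Proof.
move=> xy; rewrite /arcs (bigD1 x) //= (bigD1 y) 1?eq_sym //= big1 => [|t /andP[tx ty]].
  by rewrite !edge_eq !eqxx (negPf xy) /= orbF andbT addn0 (eq_sym x).
by rewrite edge_eq ![_ == t]eq_sym (negPf tx) (negPf ty) andbF.
Qed.

Record linkage n (mu : T -> T) (b : T -> seq T) : Prop := Linkage {
  lk_inv : involutive mu;
  lk_neq : forall t, mu t != t;
  lk_size : forall t, size (b t) = n;
  lk_head : forall t, b t = t :: behead (b t);
  lk_rev : forall t, b (mu t) = rev (b t) }.

Lemma lk_last n mu b x t : linkage n mu b -> last x (b t) = mu t.
Proof.
move=> L; rewrite -(revK (b t)) -(lk_rev L) (lk_head L (mu t)).
by rewrite rev_cons last_rcons.
Qed.

(* [p] is applied at both ends of each path; the extended path is indexed by its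
   new end [w], so that again every vertex is the start of exactly one path. *)
Definition ext_mu p (mu : T -> T) w := p (mu (p^-1 w)%g).
Definition ext_path p mu (b : T -> seq T) w :=
  w :: rcons (b (p^-1 w)%g) (ext_mu p mu w).

Lemma linkage_ext n mu b p :
  linkage n mu b -> linkage n.+2 (ext_mu p mu) (ext_path p mu b).
Proof.
move=> L; have [h1 h2 h3 h4 h5] := L.
have muK : involutive (ext_mu p mu) by move=> w; rewrite /ext_mu permK h1 permKV.
split=> //.
- move=> w; rewrite /ext_mu -[X in _ != X](permKV p) (inj_eq perm_inj); exact: h2.
- by move=> w; rewrite /= size_rcons h3.
move=> w; rewrite /ext_path muK {1 3}/ext_mu permK h5 rev_cons rev_rcons.
by rewrite -rcons_cons.
Qed.

Lemma mult_ext E n mu b p w : linkage n mu b -> 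
  mult E (ext_path p mu b w) = mult E (b (p^-1 w)%g) + (E == edge (p^-1 w)%g w)
    + (E == edge (mu (p^-1 w)%g) (p (mu (p^-1 w)%g))).
Proof.
move=> L; rewrite /ext_path (@mult_wrap _ _ _ _ _ (p^-1 w)%g (mu (p^-1 w)%g)).
- by rewrite edgeC; congr (_ + _); rewrite addnC.
- by rewrite (lk_head L).
- exact: lk_last L.
by rewrite (lk_head L).
Qed.

Lemma sum_mult_ext E n mu b p : linkage n mu b ->
  \sum_w mult E (ext_path p mu b w) = \sum_t mult E (b t) + 2 * arcs E p.
Proof.
move=> L; have inv := inv_bij (lk_inv L).
under eq_bigr do rewrite (mult_ext E p _ L).
rewrite (reindex_inj (@perm_inj _ p)) /= !big_split /=.
under eq_bigr do rewrite permK.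
under [X in _ + X + _]eq_bigr do rewrite permK.
under [X in _ + _ + X]eq_bigr do rewrite permK.
rewrite -[X in _ + _ + X](reindex mu (P := predT) (F := fun t => (E == edge t (p t)) : nat)).
  by rewrite -/(arcs E p) -addnA addnn mul2n.
exact: onW_bij.
Qed.

End Linkage.

Section Initial.
Variables (T : finType) (e : rel T) (k : nat).
Hypotheses (esym : symmetric e) (eirr : irreflexive e).

Lemma matching_involution M : perfect_matching e M ->
  exists h : T -> T, [/\ involutive h, forall x, e x (h x) &
    forall x, edge x (h x) \in M].
Proof.
case=> /subsetP sub one.
have ex x : exists y, edge x y \in M.
  have /eqP/cards1P[E /setP/(_ E)] := one x; rewrite !inE eqxx => /andP[EM xE].
  have /(gedgesP esym)[u [v [_ Euv]]] := sub _ EM.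
  move: xE; rewrite Euv in_set2 => /orP[]/eqP->; first by exists v; rewrite -Euv.
  by exists u; rewrite edgeC -Euv.
pose h x := xchoose (ex x).
have hM x : edge x (h x) \in M := xchooseP (ex x).
have he x : e x (h x) by rewrite -mem_gedges //; exact: sub.
exists h; split=> // x.
have /eqP/cards1P[E /setP hE] := one (h x).
have EE F : F \in M -> h x \in F -> F = E.
  by move=> FM hF; apply/eqP; rewrite -in_set1 -hE inE FM.
have : edge (h x) (h (h x)) = edge x (h x) by rewrite [LHS]EE ?[RHS]EE ?set21 ?set22 .
by rewrite [RHS]edgeC => /edge_injr.
Qed.

(** [arcs] counts a matching edge twice for an involution, but an oriented edge once; hence the
    coefficients 1, 2, 1. *)
Lemma initial_factorisation : regular e (2 * k) ->
  (exists M1 M2 : {set {set T}},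
    [/\ perfect_matching e M1, perfect_matching e M2 & M1 :&: M2 = set0]) ->
  exists (h1 h2 : T -> T) (ps : seq {perm T}),
  [/\ involutive h1 /\ (forall x, h1 x != x), involutive h2, size ps = k.-1 &
    forall E, arcs E h1 + 2 * (\sum_(p <- ps) arcs E p) + arcs E h2 = 2 * (E \in gedges e)].
Proof.
move=> ereg [M1 [M2 [pm1 pm2 M12]]].
have [h1 [h1K h1e h1M]] := matching_involution pm1.
have [h2 [h2K h2e h2M]] := matching_involution pm2.
have h12 x : h1 x != h2 x.
  apply/eqP => h; have /setP/(_ (edge x (h1 x))) := M12.
  by rewrite !inE h1M h h2M.
have neq x y : e x y -> x != y by apply: contraTneq => ->; rewrite eirr.
pose g x y := [&& e x y, h1 x != y & h2 x != y].
have hC h x y : involutive h -> (h x == y) = (h y == x :> T).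
  by move=> hK; rewrite -(inj_eq (inv_inj hK)) hK eq_sym.
have gsym : symmetric g by move=> x y; rewrite /g esym (hC h1) // (hC h2).
have girr : irreflexive g by move=> x; rewrite /g eirr.
have greg : regular g (2 * k.-1).
  move=> x; have := ereg x; rewrite /degree (cardsD1 (h1 x)) in_set h1e.
  rewrite (cardsD1 (h2 x)) in_setD1 in_set h2e eq_sym h12 /=.
  rewrite (_ : _ :\ _ :\ _ = [set y | g x y]); last first.
    by apply/setP => y; rewrite !inE /g ![y == _]eq_sym andbA andbC [in LHS](andbC (h2 x != y)).
  by clear; lia.
have [a [ag ao ai]] := regular_orientation gsym girr greg.
have [ps [sps psE]] := perm_decomposition ao ai.
exists h1, h2, ps; split=> //; first by split=> // x; rewrite eq_sym; exact: neq.
have pe p x : p \in ps -> e x (p x).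
  move=> pps; suff : g x (p x) by case/and3P.
  have : 0 < a x (p x) by rewrite -psE lt0n sum_nat_seq_neq0; apply/hasP; exists p; rewrite // eqxx.
  by have := ag x (p x); case: (a _ _); case: (g _ _).
move=> E; have [/(gedgesP esym)[x [y [exy ->]]]|nE] := boolP (E \in gedges e); last first.
  have arcs0 f : (forall t, e t (f t)) -> arcs E f = 0.
    move=> fe; rewrite /arcs big1 // => t _; case: eqP => // EE.
    by rewrite EE mem_gedges // fe in nE.
  rewrite !arcs0 // big1_seq // => p pps; rewrite arcs0 // => t; exact: pe.
have xy := neq x y exy.
rewrite !arcsE // (hC h1 y) // (hC h2 y) //.
under eq_bigr do rewrite arcsE //.
rewrite big_split /= !psE ag /g exy /=.
case: (h1 x =P y) => [h1y|_]; case: (h2 x =P y) => [h2y|_] //.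
by have := h12 x; rewrite h1y h2y eqxx.
Qed.

Lemma initial_linkage (ps : seq {perm T}) (h : T -> T) :
  involutive h -> (forall x, h x != x) -> exists mu b,
  linkage (2 * size ps).+2 mu b /\
  forall E : {set T}, \sum_t mult E (b t) = arcs E h + 2 * (\sum_(p <- ps) arcs E p).
Proof.
move=> hK hn; elim: ps => [|p ps [mu [b [L W]]]].
  exists h, (fun t => [:: t; h t]); split.
    by split=> // t; rewrite hK.
  by move=> E; rewrite big_nil muln0 addn0; apply: eq_bigr => t _; rewrite /= !addn0.
exists (ext_mu p mu), (ext_path p mu b); split.
  by have := linkage_ext p L; rewrite /= mulnS.
by move=> E; rewrite (sum_mult_ext _ _ L) W big_cons mulnDr; clear; lia.
Qed.

End Initial.

Lemma porbit_step (T : finType) (s : {perm T}) v : porbit s (s v) = porbit s v.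
Proof. exact: (porbit_perm s 1 v). Qed.

(** * Removing rings of bad vertices *)

Section Kernel.
Variables (T : finType) (nu : {perm T}) (B : {set T}).
Hypothesis full_orbit :
  forall v, porbit nu v \subset B -> nu v != v /\ nu (nu v) = v.

(** On an orbit that leaves [B], [n v] is the number of steps back to the nearest element outside
    [B], and its parity alternates along each stretch of [B]. An orbit inside [B] has two elements,
    and the ranks select one. *)
Lemma alternating_subset : exists W : {set T}, W \subset B /\
  forall v, nu v \in B -> (nu v \in W) = (v \notin W).
Proof.
pose hit v j := ((nu^-1 ^+ j)%g v \notin B).
pose n v := find (hit v) (iota 0 #[nu^-1]%g).
have full_nu v : (porbit nu (nu v) \subset B) = (porbit nu v \subset B).
  by rewrite porbit_step.
have nP v : ~~ (porbit nu v \subset B) -> hit v (n v) /\ forall i, i < n v -> ~~ hit v i.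
  move=> nf; have : has (hit v) (iota 0 #[nu^-1]%g).
    have /subsetPn[w wv wB] := nf; move: wv; rewrite -porbitV => /porbitP[j wE].
    apply/hasP; exists (j %% #[nu^-1]%g).
      by rewrite mem_iota add0n ltn_mod order_gt0.
    by rewrite /hit expg_mod_order -wE.
  move=> hv; have := hv; rewrite has_find size_iota -/(n v) => nv.
  split; first by have := nth_find 0 hv; rewrite nth_iota.
  move=> i iv; have := before_find 0 iv; rewrite nth_iota ?add0n => [->//|].
  exact: ltn_trans iv nv.
have hitS v j : hit (nu v) j.+1 = hit v j by rewrite /hit expgS permM permK.
have nS v : nu v \in B -> ~~ (porbit nu v \subset B) -> n (nu v) = (n v).+1.
  move=> vB nf; have [h1 h2] := nP v nf; have [|h3 h4] := nP (nu v); first by rewrite full_nu.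
  case: (n (nu v)) h3 h4 => [|j] h3 h4; first by rewrite /hit expg0 perm1 vB in h3.
  congr _.+1; case: (ltngtP j (n v)) => // [/h2|] jn; first by rewrite -hitS h3 in jn.
  by have := h4 (n v).+1; rewrite hitS h1 ltnS jn => /(_ isT).
exists [set v in B | if porbit nu v \subset B then enum_rank v < enum_rank (nu v)
                     else odd (n v)].
split=> [|v vB]; first by apply/subsetP => v; rewrite inE => /andP[].
rewrite !inE vB full_nu /=; case: ifP => [full|/negbT nf].
  have [nv nnv] := full_orbit full; have vin : v \in B.
    by apply: (subsetP full); exact: porbit_id.
  rewrite nnv vin /= -leqNgt [RHS]leq_eqVlt (inj_eq (@ord_inj _)) (inj_eq enum_rank_inj).
  by rewrite (negPf nv).
rewrite nS //=; case: (boolP (v \in B)) => //= vB'.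
suff -> : n v = 0 by [].
by have [_ h] := nP v nf; case: (n v) h => // j /(_ 0 isT); rewrite /hit expg0 perm1 vB'.
Qed.

End Kernel.

Section Rings.
Variables (T : finType) (e : rel T) (mu : T -> T).
Hypotheses (gsym : symmetric e) (eirr : irreflexive e) (muK : involutive mu).
Implicit Types (r s : {perm T}) (t u v w x : T) (K : {set T}).

Definition simple_pair r s := forall E, arcs E r + arcs E s <= (E \in gedges e).

Lemma simple_pair_neq r s : simple_pair r s ->
  [/\ forall v, r v != s v, forall v, r (r v) != v, forall v, s (s v) != v &
      forall v, r (s v) != v].
Proof.
move=> S.
have loop v : arcs (edge v v) r + arcs (edge v v) s = 0.
  by apply/eqP; rewrite -leqn0; apply: leq_trans (S _) _; rewrite mem_gedges ?eirr.
have rv v : r v != v.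
  apply/negP => /eqP E; have := loop v; rewrite /arcs (bigD1 v) //= E eqxx; clear; lia.
have sv v : s v != v.
  apply/negP => /eqP E; have := loop v.
  rewrite /arcs [X in _ + X](bigD1 v) //= E eqxx; clear; lia.
have S1 x y : x != y -> (r x == y) + (r y == x) + ((s x == y) + (s y == x)) <= 1.
  by move=> xy; rewrite -!arcsE //; apply: leq_trans (S _) _; case: (_ \in _).
split=> v; apply/eqP => E.
- by have := S1 v (r v); rewrite eq_sym rv -E !eqxx => /(_ isT); clear; lia.
- by have := S1 v (r v); rewrite eq_sym rv E !eqxx => /(_ isT); clear; lia.
- by have := S1 v (s v); rewrite eq_sym sv E !eqxx => /(_ isT); clear; lia.
- by have := S1 v (s v); rewrite eq_sym sv E !eqxx => /(_ isT); clear; lia.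
Qed.

(* [v] is bad if extending along [s] closes the path from [v] into a cycle. *)
Definition bad r s := [set v | s v == ext_mu r mu v].
(** Composition reads from left to right: the [r]-arc of [nu r s v] ends where the [s]-arc of [v]
    ends. *)
Definition nu r s := (s * r^-1)%g.
(** The orbits not covered by [alternating_subset]: wholly bad and of more than two elements. *)
Definition rings r s :=
  [set v | (porbit (nu r s) v \subset bad r s) && (nu r s (nu r s v) != v)].

Lemma nuE r s v : r (nu r s v) = s v.
Proof. by rewrite permM permKV. Qed.

Lemma nuVE r s v : s ((nu r s)^-1 v)%g = r v.
Proof. by rewrite -(nuE r s) permKV. Qed.

Lemma rings_nu r s v : (nu r s v \in rings r s) = (v \in rings r s).
Proof. by rewrite !inE (inj_eq perm_inj) porbit_step. Qed.

Lemma rings_nuV r s v : ((nu r s)^-1%g v \in rings r s) = (v \in rings r s).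
Proof. by rewrite -rings_nu permKV. Qed.

Lemma rings_bad r s v : v \in rings r s -> v \in bad r s.
Proof. by rewrite inE => /andP[/subsetP H _]; apply/H/porbit_id. Qed.

Lemma bad_ext r s t : (r t \in bad r s) = (s (r t) == r (mu t)).
Proof. by rewrite inE /ext_mu permK. Qed.

Definition minimal r s := forall r' s',
  (forall E, arcs E r' + arcs E s' = arcs E r + arcs E s) -> #|bad r s| <= #|bad r' s'|.

Lemma minimal_ring r s u : simple_pair r s -> minimal r s -> u \in rings r s ->
  s (s (nu r s u)) = u.
Proof.
move=> S min uK; have [rs rr ss rsn] := simple_pair_neq S.
set K := rings r s in uK.
(* [f] and [h] exchange [r] and [s] on [K]; this makes [K] good, and only the
   vertices [s u] with [s (s u)] the [nu]-predecessor of [u] can turn bad. *)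
pose f v := if v \in K then s v else r v.
pose h v := if v \in K then r v else s v.
have fI : injective f.
  move=> v w; rewrite /f; case: ifP => vK; case: ifP => wK; try exact: perm_inj.
    by rewrite -(nuE r s) => /perm_inj E; rewrite -E rings_nu vK in wK.
  by rewrite -[s w](nuE r s) => /perm_inj E; rewrite E rings_nu wK in vK.
have hI : injective h.
  move=> v w; rewrite /h; case: ifP => vK; case: ifP => wK; try exact: perm_inj.
    by rewrite -(nuVE r s) => /perm_inj E; rewrite -E rings_nuV vK in wK.
  by rewrite -[r w](nuVE r s) => /perm_inj E; rewrite E rings_nuV wK in vK.
have badK v : v \in K -> ext_mu r mu v = s v.
  by move=> /rings_bad; rewrite inE => /eqP.
have KL v : v \in K -> s v \notin K.
  move=> vK; apply/negP => /badK E; case/eqP: (ss v).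
  by rewrite -E -(badK v vK) /ext_mu permK muK permKV.
have rmu t : t \in K -> r (mu t) = (nu r s)^-1%g t.
  move=> tK; have := badK ((nu r s)^-1%g t); rewrite rings_nuV => /(_ tK).
  by rewrite nuVE /ext_mu => /perm_inj E; rewrite -[in LHS]E muK permKV.
have sub : bad (perm fI) (perm hI) \subset
    (bad r s :\: K) :|: [set s u | u in [set u in K | s (s u) == (nu r s)^-1%g u]].
  apply/subsetP => w; rewrite -(permKV (perm fI) w); move: ((perm fI)^-1 w)%g => t.
  rewrite bad_ext !permE in_setU in_setD => badw.
  have [tK|tK] := boolP (t \in K).
    have mtK : mu t \notin K.
      apply/negP => mtK; have := rmu t tK; rewrite -(nuVE r s) => E.
      by have := KL ((nu r s)^-1%g (mu t)); rewrite E !rings_nuV => /(_ mtK); rewrite tK.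
    move: badw; rewrite {1 2}/f tK (negPf mtK) /h (negPf (KL _ tK)) rmu // => badw.
    by apply/orP; right; apply/imsetP; exists t; [rewrite in_set tK badw|rewrite /f tK].
  have ft : f t = r t by rewrite /f (negPf tK).
  rewrite ft in badw *.
  have [wK|wK] := boolP (r t \in K).
    have := badK _ wK; rewrite /ext_mu permK -(nuE r s) => /perm_inj mt.
    move: badw; rewrite /h wK /f mt rings_nu wK -(nuVE r s) => /eqP/perm_inj E.
    by have := wK; rewrite inE -E permKV eqxx andbF.
  have mtK : mu t \notin K.
    by apply/negP => /[dup] mtK /rmu; rewrite muK => E; rewrite E rings_nuV mtK in wK.
  by move: badw; rewrite /h /f (negPf wK) (negPf mtK) bad_ext => ->.
have arcsfh E : arcs E (perm fI) + arcs E (perm hI) = arcs E r + arcs E s.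
  rewrite /arcs -!big_split /=; apply: eq_bigr => v _; rewrite !permE /f /h.
  by case: ifP => // _; rewrite addnC.
set Q := [set _ in K | _] in sub.
have QK : Q \subset K by apply/subsetP => v; rewrite inE => /andP[].
have Kbad : K \subset bad r s by apply/subsetP => v; exact: rings_bad.
(* Minimality: all of [K] turns good and at most [#|Q|] vertices turn bad, so [Q] is the whole of
   [K]. *)
have : #|K| <= #|Q|.
  have := min _ _ arcsfh; rewrite -(cardsID K (bad r s)) (setIidPr Kbad) => le.
  have := leq_trans le (leq_trans (subset_leq_card sub) (leq_card_setU _ _)).
  by rewrite card_imset; [clear; lia | exact: perm_inj].
rewrite (geq_leqif (subset_leqif_cards QK)) => /eqP QE.
have : nu r s u \in Q by rewrite QE rings_nu.
by rewrite inE permK => /andP[_ /eqP].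
Qed.

(** By [minimal_ring], [s] maps [K] to [L] and back, so [s] can be reversed on [J], and the new pair
    is again minimal. A new ring avoids [K], now good, and [L]; there [nu] is unchanged, so it would
    be an old ring and lie in [K]. *)
Lemma minimal_reverse_ring r s : simple_pair r s -> minimal r s ->
  exists s' : {perm T}, (forall E, arcs E s' = arcs E s) /\ rings r s' = set0.
Proof.
move=> S min; have [rs rr ss rsn] := simple_pair_neq S.
set K := rings r s; pose L := [set s u | u in K]; pose J := K :|: L.
have back := minimal_ring S min; rewrite -/K in back.
have backV u : u \in K -> s (s u) = (nu r s)^-1%g u.
  by move=> uK; have := back ((nu r s)^-1%g u); rewrite permKV; apply; rewrite rings_nuV.
have sJ v : v \in J -> s v \in J.
  rewrite in_setU => /orP[vK|/imsetP[u uK ->]]; first by rewrite in_setU imset_f ?orbT.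
  by rewrite in_setU backV // rings_nuV uK.
have sVJ v : v \in J -> s^-1%g v \in J.
  rewrite in_setU => /orP[vK|/imsetP[u uK ->]]; last by rewrite permK in_setU uK.
  by rewrite -[v]back // permK in_setU imset_f ?orbT ?rings_nu.
have sJE v : (s v \in J) = (v \in J).
  by apply/idP/idP => [/sVJ|]; [rewrite permK | exact: sJ].
(* Reversing [s] on [J] makes [K] good and keeps the number of bad vertices. *)
pose f v := if v \in J then s^-1%g v else s v.
have fI : injective f.
  move=> v w; rewrite /f; case: ifP => vJ; case: ifP => wJ; try exact: perm_inj.
    by move=> E; have := sVJ v vJ; rewrite E sJE wJ.
  by move=> E; have := sVJ w wJ; rewrite -E sJE vJ.
pose s' := perm fI; have s'E v : s' v = f v by rewrite permE.
have arcs' E : arcs E s' = arcs E s.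
  rewrite /arcs (bigID (fun v => v \in J)) [RHS](bigID (fun v => v \in J)) /=; congr (_ + _).
    rewrite (reindex_inj (@perm_inj _ s)) /= (eq_bigl (fun v => v \in J)) //.
    by apply: eq_bigr => v vJ; rewrite s'E /f sJE vJ permK edgeC.
  by apply: eq_bigr => v vJ; rewrite s'E /f (negPf vJ).
have bad' v : v \in bad r s' -> v \notin K /\ (v \notin L -> v \in bad r s).
  rewrite inE s'E /f in_setU => vb; have [vK|vK] := boolP (v \in K).
    move: (rings_bad vK) vb; rewrite inE vK => /eqP <- /eqP E.
    by case/eqP: (ss v); rewrite -E permKV.
  by split=> // vL; rewrite inE; move: vb; rewrite (negPf vK) (negPf vL).
have min' : minimal r s'.
  move=> r2 s2 A2; apply: (@leq_trans #|bad r s|); last first.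
    by apply: min => E; rewrite A2 arcs'.
  have sub : bad r s' \subset (bad r s :\: K) :|: L.
    apply/subsetP => v /bad'[vK vL]; rewrite in_setU in_setD vK /=.
    by case: (boolP (v \in L)) => [|/vL ->]; rewrite ?orbT.
  apply: leq_trans (subset_leq_card sub) _; apply: leq_trans (leq_card_setU _ _) _.
  have Kbad : K \subset bad r s by apply/subsetP => v; exact: rings_bad.
  rewrite -(cardsID K (bad r s)) (setIidPr Kbad) card_imset; last exact: perm_inj.
  by rewrite addnC.
have S' : simple_pair r s' by move=> E; rewrite arcs'; exact: S.
have back' := minimal_ring S' min'.
exists s'; split=> //; apply/setP => v; rewrite [RHS]inE; apply/negP => vR.
have orbR i : ((nu r s' ^+ i)%g v \in rings r s').
  by elim: i => [|i IH]; rewrite ?expg0 ?perm1 // expgSr permM rings_nu.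
(* For [w = s u], [minimal_ring] applied to the new pair yields [x = r u] and [r x = u], impossible
   for a simple pair. *)
have noL w : w \in rings r s' -> w \notin L.
  move=> wR; apply/negP => /imsetP[u uK wE].
  have s'w : s' w = u by rewrite s'E /f wE sJE in_setU uK /= permK.
  have := back' w wR; set x := nu r s' w => xE.
  have xR : x \in rings r s' by rewrite rings_nu.
  have [xK _] := bad' _ (rings_bad xR).
  have s'J y : s' y \in J -> y \in J.
    by rewrite s'E /f; case: ifP => // yJ; rewrite sJE yJ.
  have wJ : w \in J by rewrite wE sJE in_setU uK.
  have xJ : s' x \in J by apply: s'J; rewrite xE.
  have xw : x = s (s w) by rewrite -xE s'E /f xJ permKV s'E /f (s'J _ xJ) permKV.
  have xu : x = r u by rewrite xw wE (backV u) // nuVE.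
  by case/eqP: (rr u); rewrite -xu /x nuE.
have nuEq i : (nu r s' ^+ i)%g v = (nu r s ^+ i)%g v.
  elim: i => [|i IH]; rewrite ?expg0 // !expgSr !permM -IH.
  have wR := orbR i; set w := (nu r s' ^+ i)%g v in wR *.
  have [wK _] := bad' _ (rings_bad wR); have wL := noL w wR.
  apply: (@perm_inj _ r); rewrite !permKV s'E /f ifN // in_setU negb_or wK; exact: wL.
have [vK _] := bad' _ (rings_bad vR); case/negP: vK.
rewrite inE; apply/andP; split.
  apply/subsetP => w /porbitP[i ->]; rewrite -nuEq.
  by apply: (bad' _ (rings_bad (orbR i))).2; exact: noL.
have := vR; rewrite inE => /andP[_].
by have := nuEq 2; rewrite !expgS !expg0 !mulg1 !permM => ->.
Qed.

Lemma ring_free_pair r s : simple_pair r s -> exists r' s',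
  (forall E, arcs E r' + arcs E s' = arcs E r + arcs E s) /\ rings r' s' = set0.
Proof.
move=> S.
pose same (q : {perm T} * {perm T}) :=
  [forall E : {set T}, arcs E q.1 + arcs E q.2 == arcs E r + arcs E s].
have same0 : same (r, s) by apply/forallP => E; exact: eqxx.
case: (@arg_minnP _ (r, s) same (fun q => #|bad q.1 q.2|) same0) => -[r1 s1] /= /forallP A min.
have S1 : simple_pair r1 s1 by move=> E; rewrite (eqP (A E)).
have min1 : minimal r1 s1.
  move=> r2 s2 A2; apply: (min (r2, s2)); apply/forallP => E /=.
  by rewrite A2; exact: A.
have [s2 [A2 R2]] := minimal_reverse_ring S1 min1.
by exists r1, s2; split=> // E; rewrite A2 (eqP (A E)).
Qed.

End Rings.

(** * Decomposition into paths with 2k vertices *)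

Section LongTrails.
Variables (T : finType) (e : rel T) (k n : nat) (mu : T -> T) (b : T -> seq T).
Variables (r s : {perm T}) (h : T -> T).
Hypotheses (gsym : symmetric e) (eirr : irreflexive e).
Hypothesis eg : girth_at_least e (2 * k - 2).
Hypotheses (nk : n.+2 = 2 * k - 2) (L : linkage n mu b) (hK : involutive h).
Hypothesis wtE : forall E, \sum_t mult E (b t) + 2 * (arcs E r + arcs E s) + arcs E h
  = 2 * (E \in gedges e).
Hypothesis noring : rings mu r s = set0.
Implicit Types (u v w x : T) (E : {set T}).

Let m := ext_mu r mu.
Let S := ext_path r mu b.
Let LS : linkage n.+2 m S := linkage_ext r L.
Let N := nu r s.

Let neqs : [/\ forall v, r v != s v, forall v, r (r v) != v, forall v, s (s v) != v &
  forall v, r (s v) != v].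
Proof.
apply: (simple_pair_neq gsym eirr) => E; have := wtE E; clear; lia.
Qed.

Let rNE v : r (N v) = s v. Proof. exact: nuE. Qed.

Let trail_of (n' : nat) (m' : T -> T) (p : T -> seq T) : linkage n' m' p ->
  (forall E, \sum_t mult E (p t) <= 2 * (E \in gedges e)) -> forall v, trail e (p v).
Proof.
move=> L' W v E.
have := @sum_ge2 _ [set: T] (fun v => mult E (p v)) v (m' v) (in_setT _) (in_setT _).
rewrite eq_sym (lk_neq L') (lk_rev L') mult_rev => /(_ isT) H.
have := W E; rewrite (eq_bigl (fun t => t \in [set: T])) => [|t]; last by rewrite in_setT.
by move: H; case: (E \in _); clear; lia.
Qed.

Let S_uniq v : uniq (S v).
Proof.
apply: (trail_uniq gsym eirr eg); last by rewrite (lk_size LS) nk.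
apply: (trail_of LS) => E; rewrite (sum_mult_ext _ _ L); have := wtE E; clear; lia.
Qed.

(** Otherwise the shorter path [b (r^-1 v)] would end at [v], which would then occur twice on
    [S v]. *)
Let m_neq_r v : m v != r v.
Proof.
apply/eqP => /perm_inj E; have := S_uniq v.
rewrite /S /ext_path /= mem_rcons inE negb_or => /andP[/andP[_ /negP H] _]; apply: H.
by rewrite -[X in X \in _]E -(lk_last (r^-1 v)%g _ L) (lk_head L) /= mem_last.
Qed.

Let kernel : exists W : {set T}, W \subset bad mu r s /\
  forall v, N v \in bad mu r s -> (N v \in W) = (v \notin W).
Proof.
apply: alternating_subset => v full; split.
  by apply/eqP => E; have [/(_ v)/eqP rs _ _ _] := neqs; apply: rs; rewrite -rNE E.
apply/eqP; have /setP/(_ v) := noring; rewrite !inE full /= => /negbFE; exact.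
Qed.

Section Kernel.
Variable W : {set T}.
Hypotheses (WB : W \subset bad mu r s)
  (NW : forall v, N v \in bad mu r s -> (N v \in W) = (v \notin W)).

Let W_s v : v \in W -> m v = s v.
Proof. by move/(subsetP WB); rewrite inE => /eqP. Qed.

Let W_N v : v \in W -> N v \notin W.
Proof.
by move=> vW; apply/negP => NvW; have := NW (subsetP WB _ NvW); rewrite NvW vW.
Qed.

Let W_m v : v \in W -> m v \notin W.
Proof.
move=> vW; apply/negP => /W_s; rewrite (lk_inv LS) W_s // => E.
by have [_ _ /(_ v)/eqP ss _] := neqs; apply: ss.
Qed.

(* At [v] in [W] the bad extension is avoided by using the [s]-arc from [v] to
   [m v] inside the path: it replaces the [r]-arc from [N v] to [m v], which in
   turn is used as the extension at [N v]. *)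
Let swap v := if v \in W then N v else if (N^-1)%g v \in W then (N^-1)%g v else v.

Let swapK : involutive swap.
Proof.
move=> v; rewrite /swap; have [vW|vW] := boolP (v \in W).
  by rewrite (negPf (W_N vW)) permK vW.
by have [uW|uW] := boolP ((N^-1)%g v \in W); rewrite ?uW ?permKV // (negPf vW) (negPf uW).
Qed.

Let eps_inj : injective (s \o swap).
Proof. exact: inj_comp (@perm_inj _ s) (inv_inj swapK). Qed.
Let eps := perm eps_inj.
Let epsE v : eps v = s (swap v). Proof. by rewrite permE. Qed.

Let hd v := if v \in W then N v else v.
Let core v := if v \in W then rotate (m v) (S v) else
  if m v \in W then rev (rotate v (S (m v))) else S v.

Let core_m v : core (m v) = rev (core v).
Proof.
rewrite /core (lk_inv LS); have [vW|vW] := boolP (v \in W).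
  by rewrite (negPf (W_m vW)).
by have [mW|mW] := boolP (m v \in W); rewrite ?revK // (lk_rev LS).
Qed.

Let m_in_S v : m v \in behead (S v).
Proof. by rewrite /S /= mem_rcons inE eqxx. Qed.

Let size_core v : size (core v) = n.+2.
Proof.
rewrite /core; case: ifP => _; last case: ifP => _;
  by rewrite ?size_rev ?size_rotate (lk_size LS).
Qed.

Let pred_S v : v \in W -> pred_on (m v) (v :: behead (S v)) = N v.
Proof.
move=> vW; rewrite -(lk_head LS).
have SE : S v = (v :: b (r^-1 v)%g) ++ [:: m v] by rewrite cats1.
have := S_uniq v; rewrite SE cat_uniq => /and3P[_ /=]; rewrite orbF => mv _.
rewrite -cat_cons pred_onE //= (lk_head L) /= -[LHS]/(last (r^-1 v)%g (r^-1 v :: _))%g.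
rewrite -(lk_head L) (lk_last _ _ L); apply: (@perm_inj _ r).
by rewrite rNE -W_s.
Qed.

Let core_head v : core v = hd v :: behead (core v).
Proof.
have cons0 (p : seq T) x : size p = n.+2 -> head x p = x -> p = x :: behead p.
  by case: p => //= a p _ ->.
apply: cons0 => //; rewrite /core /hd; case: ifP => vW.
  by rewrite (lk_head LS) head_rotate ?m_in_S ?(lk_neq LS) // pred_S.
case: ifP => mW; last by rewrite (lk_head LS).
have vS : v \in S (m v) by rewrite (lk_rev LS) mem_rev (lk_head LS) mem_head.
have : last v (rotate v (S (m v))) = v.
  by rewrite last_rotate // (lk_last _ _ LS) (lk_inv LS).
by case/lastP: (rotate _ _) => [|p a] //; rewrite last_rcons rev_rcons.
Qed.

Let core_last x v : last x (core v) = hd (m v).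
Proof. by rewrite -(revK (core v)) -core_m core_head rev_cons last_rcons. Qed.

Let R v := eps v :: rcons (core v) (eps (m v)).

Let mult_R E v : mult E (R v) = (E == edge (hd v) (eps v)) + mult E (core v)
  + (E == edge (hd (m v)) (eps (m v))).
Proof.
rewrite /R (@mult_wrap _ _ _ _ _ (hd v) (hd (m v))) ?core_last // 1?core_head //.
by rewrite edgeC.
Qed.

Let R_linkage : linkage n.+4 (fun u => eps (m (eps^-1 u)%g)) (fun u => R (eps^-1 u)%g).
Proof.
split.
- by move=> u; rewrite permK (lk_inv LS) permKV.
- by move=> u; rewrite -[X in _ != X](permKV eps) (inj_eq perm_inj) (lk_neq LS).
- by move=> u; rewrite /= size_rcons size_core.
- by move=> u; rewrite /R permKV.
- by move=> u; rewrite permK /R (lk_inv LS) core_m rev_cons rev_rcons.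
Qed.

Let sum_mult_R E : \sum_v mult E (R v) = \sum_t mult E (b t) + 2 * (arcs E r + arcs E s).
Proof.
(* [fA] counts the [r]-arcs leaving the inside of the paths, [fB] the [s]-arcs moved inside, and
   [fC] the [s]-arcs that pass from the end [N v] to the end [v]; the last cancel when summed over
   [N]. *)
pose fA v := (v \in W) * (E == edge (N v) (r (N v))).
pose fB v := (v \in W) * (E == edge v (s v)).
pose fC v := (v \in W) * (E == edge (N v) (s (N v))).
have sum_m (F : T -> nat) : \sum_v F (m v) = \sum_v F v.
  by rewrite [RHS](reindex_inj (inv_inj (lk_inv LS))).
have sum_N (F : T -> nat) : \sum_v F (N^-1 v)%g = \sum_v F v.
  by rewrite [RHS](reindex_inj (@perm_inj _ N^-1)).
have mS v : v \in W -> mult E (rotate (m v) (S v)) + fA v = mult E (S v) + fB v.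
  move=> vW; rewrite /fA /fB vW !mul1n rNE -W_s //.
  have := mult_rotate E (m_in_S v) (lk_neq LS v).
  by rewrite pred_S // -(lk_head LS).
have core1 v : mult E (core v) + fA v + fA (m v) = mult E (S v) + fB v + fB (m v).
  rewrite /core; have [vW|vW] := boolP (v \in W).
    by rewrite mS // /fA /fB (negPf (W_m vW)).
  rewrite {1}/fA {1}/fB (negPf vW) !mul0n !addn0.
  have [mW|mW] := boolP (m v \in W); last by rewrite /fA /fB (negPf mW).
  have := mS _ mW; rewrite (lk_inv LS) mult_rev => ->.
  by rewrite (lk_rev LS) mult_rev.
have end1 v : (E == edge (hd v) (eps v)) + fB v + fC (N^-1 v)%g =
    (E == edge v (s v)) + fC v + fA (N^-1 v)%g.
  rewrite epsE /hd /swap; have [vW|vW] := boolP (v \in W).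
    have uW : (N^-1 v)%g \notin W.
      by apply/negP => /W_N; rewrite permKV vW.
    by rewrite /fA /fB /fC vW (negPf uW) !mul0n !mul1n !addn0 addnC.
  rewrite {1}/fB {2}/fC (negPf vW) !mul0n !addn0 /fA /fC permKV.
  by have [uW|uW] := boolP ((N^-1)%g v \in W); rewrite ?mul1n ?mul0n // -rNE permKV addnC.
have sum1 : \sum_v mult E (core v) + 2 * \sum_v fA v = \sum_v mult E (S v) + 2 * \sum_v fB v.
  have : \sum_v (mult E (core v) + fA v + fA (m v)) = \sum_v (mult E (S v) + fB v + fB (m v)).
    by apply: eq_bigr => v _; exact: core1.
  rewrite !big_split /= !sum_m; clear; lia.
have sum2 : \sum_v (E == edge (hd v) (eps v)) + \sum_v fB v = arcs E s + \sum_v fA v.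
  have : \sum_v ((E == edge (hd v) (eps v)) + fB v + fC (N^-1 v)%g) =
    \sum_v ((E == edge v (s v)) + fC v + fA (N^-1 v)%g).
    by apply: eq_bigr => v _; exact: end1.
  rewrite !big_split /= !sum_N /arcs; clear; lia.
under eq_bigr do rewrite mult_R.
rewrite !big_split /= (sum_m (fun v => (E == edge (hd v) (eps v)) : nat)).
have := sum_mult_ext E r L; rewrite -/S; move: sum1 sum2; clear; lia.
Qed.

(** The condition [NW] settles the last case: a bad [v] outside [W] has its [N]-predecessor in [W].
    The other cases contradict [neqs] or [m_neq_r]. *)
Let eps_neq v : eps v != hd (m v).
Proof.
have [rs rr ss rsn] := neqs.
rewrite epsE /hd /swap; apply/eqP; have [vW|vW] := boolP (v \in W).
  rewrite (negPf (W_m vW)) W_s // => /perm_inj E.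
  by case/eqP: (rs v); rewrite -rNE E.
have sN u : (N^-1)%g v = u -> s u = r v by move=> <-; rewrite -rNE permKV.
have [mW|mW] := boolP (m v \in W).
  case: ifP => _ E.
    by case/eqP: (rr v); rewrite -(sN _ (erefl _)) E rNE -W_s // (lk_inv LS).
  by case/eqP: (rsn v); rewrite E rNE -W_s // (lk_inv LS).
case: ifP => [_|/negP uW] E; first by case/eqP: (m_neq_r v); rewrite -E (sN _ (erefl _)).
have vB : N ((N^-1)%g v) \in bad mu r s by rewrite permKV inE E.
by have := NW vB; rewrite permKV (negPf vW) => /esym/negbFE.
Qed.

(** The core has 2k-2 vertices, so the girth makes it a path, and a new end could only meet the far
    end of the core, which [eps_neq] forbids. *)
Let R_uniq v : uniq (R v).
Proof.
have R_trail w : trail e (R w).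
  have := @trail_of _ _ _ R_linkage _ (eps w); rewrite permK; apply=> E.
  rewrite (reindex_inj (@perm_inj _ eps)) /=; under eq_bigr do rewrite permK.
  rewrite sum_mult_R; have := wtE E; clear; lia.
have ec_trail w : trail e (eps w :: core w).
  move=> E; apply: leq_trans (R_trail w E); rewrite mult_R core_head mult_cons2 edgeC.
  exact: leq_addr.
have core_uniq w : uniq (core w).
  apply: (trail_uniq gsym eirr eg); last by rewrite size_core nk.
  exact: trail_cons (ec_trail w).
have notin w : eps w \notin core w.
  apply/negP => ew; have := back_edge gsym eirr eg (ec_trail w) (core_uniq w) ew.
  have := ew; rewrite -index_mem size_core -nk => i1 i2.
  case/eqP: (eps_neq w); rewrite -(core_last (eps w)) -nth_last size_core /=.
  by rewrite (_ : n.+1 = index (eps w) (core w)) ?nth_index //; move: i1 i2; clear; lia.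
rewrite /R /= mem_rcons inE negb_or (inj_eq perm_inj) eq_sym (lk_neq LS) notin /=.
by rewrite rcons_uniq core_uniq andbT -mem_rev -core_m notin.
Qed.

Lemma kernel_linked : exists P o, linked e k setT P o h /\
  forall E, wt setT P h E = 2 * (E \in gedges e).
Proof.
pose P u := R (eps^-1 u)%g; pose o u := eps (m (eps^-1 u)%g).
have wtP E : wt setT P h E = 2 * (E \in gedges e).
  rewrite /wt big_split /= -wtE -sum_mult_R /arcs; congr (_ + _); last first.
    by apply: eq_bigl => v; rewrite in_setT.
  rewrite (reindex_inj (@perm_inj _ eps)); apply: eq_big => v; first by rewrite in_setT.
  by rewrite /P permK.
exists P, o; split=> //; have [h1 h2 h3 h4 h5] := R_linkage.
split=> [v|v|v|v|v|v|v|v|v|E]; rewrite ?in_setT ?wtP // => _ //.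
- exact: h1.
- exact: h2.
- exact: h5.
- by rewrite /P h3; move: nk; clear; lia.
- exact: R_uniq.
- exact: h4.
Qed.

End Kernel.

Lemma long_trails : exists P o, linked e k setT P o h /\
  forall E, wt setT P h E = 2 * (E \in gedges e).
Proof. by have [W [WB NW]] := kernel; exact: kernel_linked WB NW. Qed.

End LongTrails.

(** * Assembly of the decomposition *)

Theorem mainTheorem3 (k : nat) (T : finType) (e : rel T) :
  3 <= k -> in_Gk k e ->
  exists D : seq (piece T),
    k_balanced_decomposition k e D /\
    all (fun d => ~~ is_path_piece d ==> (piece_length d == 2 * k)) D.
Proof.
move=> k3 [[esym eirr] [ereg [eg matchings]]].
have [h1 [h2 [ps [[h1K h1n] h2K sps W]]]] := initial_factorisation esym eirr ereg matchings.
(* As k-1 is at least 2, two permutations [r] and [s] can be reserved for the last two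
   extensions. *)
case: ps sps W => [|r [|s ps]] /= sps W; [by move: k3 sps; clear; lia..|].
have [mu [b [L Wb]]] := initial_linkage ps h1K h1n.
(* The remaining k-3 permutations give paths on 2k-4 vertices; [r] brings them to 2k-2, the largest
   size at which the girth still makes every trail a path. *)
have nk : (2 * size ps).+4 = 2 * k - 2 by move: k3 sps; clear; lia.
have {}W E : \sum_t mult E (b t) + 2 * (arcs E r + arcs E s) + arcs E h2
    = 2 * (E \in gedges e).
  by rewrite -W Wb !big_cons; clear; lia.
have rs_simple : simple_pair e r s by move=> E; have := W E; clear; lia.
have [r' [s' [A noring]]] := ring_free_pair esym eirr (lk_inv L) rs_simple.
have W' E : \sum_t mult E (b t) + 2 * (arcs E r' + arcs E s') + arcs E h2
    = 2 * (E \in gedges e) by rewrite A.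
have [P [o [LP wtP]]] := long_trails esym eirr eg nk L h2K W' noring.
have [D [D1 D2 D3 D4 D5 D6]] := linked_good esym eirr k3 eg LP.
exists D; split=> //; split=> //; split.
  split=> // E Ee; apply: count_piece_edges.
  by have := D6 E; rewrite wtP Ee; clear; lia.
by apply: sub_all D2 => d; rewrite !inE orbA.
Qed.
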